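(* Let $\{d_n\}_{n=1}^\infty\in l^1(\mathbb N)$ be a sequence of positive numbers, $c>0$, and let $\widehat\alpha_n=\mathrm{diag}(\alpha_{n,1},\alpha_{n,2},\ldots,\alpha_{n,p})=\widehat\alpha_n^*$, $n\in\mathbb N$, be (real) diagonal matrices with $|\alpha_{n,1}|\le|\alpha_{n,2}|\le\ldots\le|\alpha_{n,p}|$. Let $\mathbf J_{X,\widehat\alpha}$ be the minimal Jacobi operator in $l^2(\mathbb N_0;\mathbb C^p)$ associated with the block Jacobi matrix whose diagonal entries are $\mathcal A_0=\mathbb O_p$, $\mathcal A_{2j}=\frac{\widehat\alpha_j}{d_{j+1}}$ ($j\ge1$), $\mathcal A_{2j+1}=-\frac{\nu(d_{j+1})}{d_{j+1}^2}\mathbb I_p$ ($j\ge0$), and whose off-diagonal entries are $\mathcal B_{2j}=\frac{\nu(d_{j+1})}{d_{j+1}^2}\mathbb I_p$, $\mathcal B_{2j+1}=\frac{\nu(d_{j+1})}{d_{j+1}^{3/2}d_{j+2}^{1/2}}\mathbb I_p$ ($j\ge0$), where $\nu(x)=\frac{cx}{\sqrt{1+c^2x^2}}$. (i) If $$\sum_{n\in\mathbb N}\sqrt{d_nd_{n+1}}\,|\alpha_{n,1}|=+\infty,$$ then $\mathbf J_{X,\widehat\alpha}$ is selfadjoint, $\mathbf J_{X,\widehat\alpha}=\mathbf J_{X,\widehat\alpha}^*$. (ii) Assume in addition (to the condition in (i)) that $$\lim_{n\to\infty}\frac{|\alpha_{n,1}|}{d_{n+1}}=\infty,\qquad\lim_{n\to\infty}\frac{c}{\alpha_{n,1}}>-\frac14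 .$$ Then the spectrum of the Jacobi operator $\mathbf J_{X,\widehat\alpha}=\mathbf J_{X,\widehat\alpha}^*$ is discrete.
   Context: A block Jacobi matrix with entries $\mathcal A_n=\mathcal A_n^*$, $\mathcal B_n$ (invertible) in $\mathbb C^{p\times p}$, $n\in\mathbb N_0$, acts by $(\mathbf Jf)_n=\mathcal B_{n-1}^*f_{n-1}+\mathcal A_nf_n+\mathcal B_nf_{n+1}$ (with the term containing $f_{-1}$ omitted for $n=0$); the minimal operator is the closure in $l^2(\mathbb N_0;\mathbb C^p)$ of this map restricted to finitely supported sequences. A selfadjoint operator has discrete spectrum if its resolvent is compact. $\mathbb I_p,\mathbb O_p$ are the identity and zero $p\times p$ matrices. The second limit in (ii) is assumed to exist. *)

(* Defs.v *)
From HB Require Import structures.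
From mathcomp Require Import all_boot all_order all_algebra.
From mathcomp Require Import complex.
From mathcomp Require Import all_classical all_reals all_analysis.

Set Implicit Arguments.
Unset Strict Implicit.
Unset Printing Implicit Defensive.

Import Order.TTheory GRing.Theory Num.Theory.
Import numFieldNormedType.Exports.

Local Open Scope classical_set_scope.
Local Open Scope ring_scope.
Local Open Scope complex_scope.

Definition vseq (R : realType) (p : nat) : Type := nat -> 'cV[R[i]]_p.

Section SquareSummable.
Context {R : realType} {p : nat}.
Implicit Types f g : vseq R p.

(* The squared norm takes values in \bar R; it is +oo exactly off l2. *)
Definition l2norm_sq f : \bar R :=
  limn (fun N : nat => \sum_(0 <= n < N)
    (\sum_(k < p) (complex.Re (f n k 0) ^+ 2 + complex.Im (f n k 0) ^+ 2))%:E)%E.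

Definition l2 : set (vseq R p) := [set f | (l2norm_sq f < +oo)%E].

Definition l2dist_sq f g : \bar R := l2norm_sq (fun n => f n - g n).

(* Linear in the first argument. The complex series is summed through its real
   and imaginary parts, since R[i] carries no canonical topology. *)
Definition l2inner f g : R[i] :=
  let t n := \sum_(k < p) f n k 0 * (g n k 0)^* in
  limn (series (fun n => complex.Re (t n)))
    +i* limn (series (fun n => complex.Im (t n))).

End SquareSummable.

(* An operator in l2 is identified with its graph: the pair (f, g) is in T
   iff f is in the domain of T and T f = g. *)
Definition operator (R : realType) (p : nat) : Type :=
  set (vseq R p * vseq R p).

Section Operators.
Context {R : realType} {p : nat}.
Implicit Types T K : operator R p.

Definition domain T : set (vseq R p) := [set f | exists g, T (f, g)].

Definition densely_defined T : Prop :=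
  forall f, l2 f -> forall e : R, 0 < e ->
    exists2 h, domain T h & (l2dist_sq f h < e%:E)%E.

(* Closure of the graph in l2 x l2. *)
Definition closure_op T : operator R p :=
  [set fg | [/\ l2 fg.1, l2 fg.2 &
     forall e : R, 0 < e -> exists2 hk, T hk &
       (l2dist_sq fg.1 hk.1 < e%:E)%E /\
       (l2dist_sq fg.2 hk.2 < e%:E)%E]].

Definition adjoint T : operator R p :=
  [set gh | [/\ l2 gh.1, l2 gh.2 &
     forall f Tf, T (f, Tf) -> l2inner Tf gh.1 = l2inner f gh.2]].

(* Density makes the adjoint single-valued, so T = adjoint T also forces T to
   be the graph of an operator. *)
Definition selfadjoint T : Prop := densely_defined T /\ T = adjoint T.

(* Graph of (T - z)^-1. *)
Definition resolvent T (z : R[i]) : operator R p :=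
  [set gf | T (gf.2, fun n => gf.1 n + z *: gf.2 n)].

Definition bounded_everywhere K : Prop :=
  (forall g, l2 g -> exists! f, K (g, f)) /\
  (exists M : R, forall g f, l2 g -> K (g, f) ->
     (l2norm_sq f <= M%:E * l2norm_sq g)%E).

Definition resolvent_set T : set R[i] :=
  [set z | bounded_everywhere (resolvent T z)].

(* Images of bounded sequences have subsequences converging in l2. *)
Definition compact_op K : Prop :=
  forall u v : nat -> vseq R p,
    (forall m, l2 (u m) /\ K (u m, v m)) ->
    (exists M : R, forall m, (l2norm_sq (u m) <= M%:E)%E) ->
    exists (phi : nat -> nat) (w : vseq R p),
      [/\ {homo phi : m n / (m < n)%N}, l2 w &
          (fun m => l2dist_sq (v (phi m)) w) @ \oo --> 0%E].

Definition discrete_spectrum T : Prop :=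
  resolvent_set T !=set0 /\
  forall z, resolvent_set T z -> compact_op (resolvent T z).

End Operators.

Section BlockJacobi.
Context {R : realType} {p : nat}.
Variables A B : nat -> 'M[R[i]]_p.

Definition jacobi_action (f : vseq R p) : vseq R p := fun n =>
  (if n is m.+1 then map_mx conjc (B m)^T *m f m else 0)
    + A n *m f n + B n *m f n.+1.

Definition finitely_supported (f : vseq R p) : Prop :=
  exists N, forall n, (N <= n)%N -> f n = 0.

Definition minimal_jacobi : operator R p :=
  closure_op [set fg | finitely_supported fg.1 /\ fg.2 = jacobi_action fg.1].

End BlockJacobi.

Section DiracJacobi.
Context {R : realType} {p : nat}.
Variables (c : R) (d : nat -> R) (alpha : nat -> 'I_p -> R).

Definition nu (x : R) : R := c * x / Num.sqrt (1 + c ^+ 2 * x ^+ 2).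

(* d and alpha are used at positive indices only; j is n./2 for both
   n = 2j and n = 2j + 1. *)
Definition diagA (n : nat) : 'M[R[i]]_p :=
  let j := n./2 in
  if n == 0%N then 0
  else if odd n then (- (nu (d j.+1) / d j.+1 ^+ 2))%:C%:M
  else diag_mx (\row_k (alpha j k / d j.+1)%:C).

Definition offdiagB (n : nat) : 'M[R[i]]_p :=
  let j := n./2 in
  if odd n
  then (nu (d j.+1) / (d j.+1 `^ (3 / 2) * d j.+2 `^ (1 / 2)))%:C%:M
  else (nu (d j.+1) / d j.+1 ^+ 2)%:C%:M.

Definition J_X_alpha : operator R p := minimal_jacobi diagA offdiagB.

End DiracJacobi.

(* Main.v *)
Require Import Defs.
From HB Require Import structures.
From mathcomp Require Import all_boot all_order all_algebra.
From mathcomp Require Import complex.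
From mathcomp Require Import all_classical all_reals all_analysis.
From mathcomp Require Import ring lra zify.

(** All the coefficients are real diagonal matrices, so the operator splits into
scalar real Jacobi matrices, one for each of the p components and for the real
and imaginary parts; the only operation that mixes them is multiplication by
i, a rotation commuting with the real operator J. The proof works on the real
coordinates of vector sequences, with s_j standing for the square root of d_{j+1}
and gamma_j for nu(d_{j+1}) / d_{j+1}, which lies between two positive
constants.

Selfadjointness rests on the Wronskian W_n of two elements of the maximal
domain, which converges by Green's identity. When the even rows of the
recurrence are used to eliminate alpha_j x_{2j} and alpha_j y_{2j} from
alpha_j W_{2j}, the products x_{2j+1} y_{2j+1} cancel, and
s_{j-1} s_j alpha_j W_{2j} becomes a sum of products of square-summable terms
(wronskian_even). A nonzero limit of W would thus make the series in (i)
finite; since |alpha_{j,k}| >= |alpha_{j,1}|, this settles every component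
(dirac_limit_point). Hence J is symmetric on its maximal domain, where
therefore |JX + t iX|^2 = |JX|^2 + t^2 |X|^2 for real t
(sqnorm_jacs_mul_i). A vector orthogonal to the image under J - i of the
finitely supported sequences satisfies JX + iX = 0, hence vanishes: that image
is dense, and the norm identity makes J - i map the closure of the finitely
supported graph onto the whole space (jacs_mul_i_surj). As J - i is injective
on the maximal domain, the minimal and maximal operators coincide
(max_domain_graph_closure), and the latter is the adjoint of the former. The
same facts put i in the resolvent set.

For discreteness, first note that the square roots of d_n d_{n+1} are
summable, so that divergence in (i) forbids c / alpha_{n,1} to stay away from
0: its limit can only be 0, and all the |alpha_{n,k}| tend to infinity
(alpha_large). For a finitely supported sequence, u_j = x_{2j} / s_j then obeys
a discrete maximum principle, which bounds |x_n| by a constant times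
s_{n/2} times the graph norm (dirac_sup_bound). The bound passes to the
closure, the squares of the s_{n/2} are summable, and so bounded sets for the graph
norm are uniformly dominated by one summable sequence; such sets are relatively
compact (dominated_subsequence). *)

Set Implicit Arguments.
Unset Strict Implicit.
Unset Printing Implicit Defensive.

Import Order.TTheory GRing.Theory Num.Theory.
Import numFieldNormedType.Exports.

Local Open Scope classical_set_scope.
Local Open Scope ring_scope.

(** * Real series with nonnegative terms *)

Section SeriesComparison.
Variable R : realType.
Implicit Types u v : nat -> R.

Lemma bounded_series_cvg (u : nat -> R) (M : R) : (forall n, 0 <= u n) ->
  (forall N, series u N <= M) -> cvgn (series u) /\ limn (series u) <= M.
Proof.
move=> u0 uM.
have cu : cvgn (series u).
  apply: nondecreasing_is_cvgn; first exact: nondecreasing_series.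
  by exists M => _ [N _ <-]; exact: uM.
by split=> //; apply: limr_le => //; apply: nearW.
Qed.

Lemma series_le_lim (u : nat -> R) N : (forall n, 0 <= u n) ->
  cvgn (series u) -> series u N <= limn (series u).
Proof.
move=> u0 cu; apply: (@nondecreasing_cvgn_le _ (series u)) => //.
exact: nondecreasing_series.
Qed.

Lemma series_le_cvg_near u v N : (forall n, 0 <= u n) -> (forall n, 0 <= v n) ->
  (forall n, (N <= n)%N -> u n <= v n) -> cvgn (series v) -> cvgn (series u).
Proof.
move=> u0 v0 uv cv.
suff B n : series u n <= series u N + series v n.
  apply: (bounded_series_cvg (M := series u N + limn (series v)) u0 _).1 => n.
  by rewrite (le_trans (B n)) // lerD2l series_le_lim.
have v_ge0 k : 0 <= series v k by apply: sumr_ge0.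
have [nN|/ltnW Nn] := leqP n N.
  by rewrite -[leLHS]addr0 lerD // nondecreasing_series.
rewrite -lerBlDl sub_series_geq //.
have -> : series v n = series v N + (series v n - series v N) by rewrite addrC subrK.
rewrite -[leLHS]add0r lerD // sub_series_geq // big_nat_cond [leRHS]big_nat_cond.
by apply: ler_sum => k /andP[/andP[Nk _] _]; apply: uv.
Qed.

Lemma cvg_series_pairs u : (forall n, 0 <= u n) -> cvgn (series u) ->
  cvgn (series (fun j => u j.*2 + u j.*2.+1)).
Proof.
move=> u0 cu.
have E N : series (fun j => u j.*2 + u j.*2.+1) N = series u N.*2.
  elim: N => [|N IH]; first by rewrite /series /= !big_geq.
  by rewrite doubleS !seriesSr IH addrA.
apply: (bounded_series_cvg (M := limn (series u)) _ _).1 => N.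
  by rewrite addr_ge0.
by rewrite E series_le_lim.
Qed.

Lemma cvg_series_shift u : (forall n, 0 <= u n) -> cvgn (series u) ->
  cvgn (series (fun n => u n.+1)).
Proof.
move=> u0 cu; apply: (bounded_series_cvg (M := limn (series u)) _ _).1 => // N.
rewrite (le_trans _ (series_le_lim N.+1 u0 cu)) //.
by rewrite /series /= big_nat_recl // lerDr.
Qed.

(** For the weights: entries 2j and 2j+1 of a sequence carry the same weight d_{j+1}. *)
Lemma cvg_series_half v : (forall n, 0 <= v n) -> cvgn (series v) ->
  cvgn (series (fun n => v n./2)).
Proof.
move=> v0 cv; apply: (bounded_series_cvg (M := 2 * limn (series v)) _ _).1 => // N.
have E M : series (fun n => v n./2) M.*2 = 2 * series v M.
  elim: M => [|M IH]; first by rewrite /series /= !big_geq // mulr0.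
  by rewrite doubleS !seriesSr IH /= uphalf_double doubleK; ring.
apply: (@le_trans _ _ (series (fun n => v n./2) N.*2)).
  by apply: nondecreasing_series => [n _ _|]; rewrite ?v0 // -addnn leq_addr.
by rewrite E ler_pM2l // series_le_lim.
Qed.

Lemma exists_max_norm (u : nat -> R) N : (forall n, (N <= n)%N -> u n = 0) ->
  exists k, forall j, `|u j| <= `|u k|.
Proof.
move=> uN; have [k kP] : exists k, forall j, (j < N)%N -> `|u j| <= `|u k|.
  elim: N {uN} => [|N [k IH]]; first by exists 0%N.
  have [uk|/ltW uk] := leP `|u N| `|u k|.
    by exists k => j; rewrite ltnS leq_eqVlt => /predU1P[->|/IH].
  exists N => j; rewrite ltnS leq_eqVlt => /predU1P[->//|/IH uj]; exact: le_trans uj uk.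
by exists k => j; case: (ltnP j N) => [/kP//|/uN ->]; rewrite normr0.
Qed.

Lemma nneseries_from1 u : (forall n, 0 <= u n.+1) ->
  (\sum_(1 <= n <oo) (u n)%:E = \sum_(0 <= n <oo) (u n.+1)%:E)%E.
Proof.
move=> u0; apply: cvg_lim => //; rewrite -cvg_shiftS.
have -> : (fun N => \sum_(1 <= n < N.+1) (u n)%:E)%E =
    (fun N => \sum_(0 <= n < N) (u n.+1)%:E)%E.
  by apply/funext => N; rewrite big_add1.
by apply: is_cvg_nneseries => n _ _; rewrite lee_fin.
Qed.

Lemma nneseries_from1_finite u : (forall n, 0 <= u n.+1) ->
  (\sum_(1 <= n <oo) (u n)%:E < +oo)%E <-> cvgn (series (fun n => u n.+1)).
Proof.
move=> u0; rewrite nneseries_from1 //; split=> [|cu]; first exact: nnseries_is_cvg.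
suff -> : (\sum_(0 <= n <oo) (u n.+1)%:E = (limn (series (fun n => u n.+1)))%:E)%E.
  exact: ltry.
rewrite -EFin_lim //; congr (limn _); apply/funext => N.
by rewrite /series /= sumEFin.
Qed.

End SeriesComparison.

(** * Square-summable families of real sequences *)

Section SquareSummable.
Variables (R : realType) (I : finType).
Implicit Types X Y Z : nat -> I -> R.

Definition dot X Y : nat -> R := fun n => \sum_i X n i * Y n i.
Definition sqsum X := cvgn (series (dot X X)).
Definition inner X Y : R := limn (series (dot X Y)).
Definition sqnorm X : R := inner X X.

Lemma dotC X Y : dot X Y = dot Y X.
Proof. by apply/funext => n; apply: eq_bigr => i _; rewrite mulrC. Qed.

Lemma dotDl X t Y Z : dot (X + t *: Y) Z = dot X Z + t *: dot Y Z.
Proof.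
apply/funext => n; transitivity (dot X Z n + t * dot Y Z n) => //.
rewrite /dot mulr_sumr -big_split /=; apply: eq_bigr => i _.
by rewrite mulrA -mulrDl.
Qed.

Lemma dot_ge0 X n : 0 <= dot X X n.
Proof. by apply: sumr_ge0 => i _; rewrite -expr2 sqr_ge0. Qed.

Lemma sqr_coord_le_dot X n i : X n i ^+ 2 <= dot X X n.
Proof.
rewrite /dot (bigD1 i) //= expr2 lerDl.
by apply: sumr_ge0 => j _; rewrite -expr2 sqr_ge0.
Qed.

Lemma norm_dot_le X Y n : `|dot X Y n| <= dot X X n + dot Y Y n.
Proof.
rewrite (le_trans (ler_norm_sum _ _ _)) // -big_split ler_sum //= => i _.
by rewrite ler_norml; apply/andP; split; nra.
Qed.

Lemma cvg_series_dot X Y : sqsum X -> sqsum Y -> cvgn (series (dot X Y)).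
Proof.
move=> sX sY; apply: normed_cvg.
apply: (@series_le_cvg _ _ (dot X X + dot Y Y)) => [n|n|n|] //=.
- by rewrite fctE addr_ge0 ?dot_ge0.
- exact: norm_dot_le.
- exact: is_cvg_seriesD.
Qed.

Lemma sqsum_dom (u : nat -> R) X : (forall n, dot X X n <= u n) ->
  cvgn (series u) -> sqsum X.
Proof.
move=> Xu cu; apply: (series_le_cvg (dot_ge0 X) _ Xu cu) => n.
exact: le_trans (dot_ge0 X n) (Xu n).
Qed.

Lemma dot_comb X t Y : dot (X + t *: Y) (X + t *: Y) =
  dot X X + (t * 2) *: dot X Y + (t ^+ 2) *: dot Y Y.
Proof.
rewrite dotDl (dotC X) (dotC Y) !dotDl (dotC Y X); apply/funext => n.
transitivity (dot X X n + t * dot X Y n + t * (dot X Y n + t * dot Y Y n)) => //.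
transitivity (dot X X n + t * 2 * dot X Y n + t ^+ 2 * dot Y Y n) => //; ring.
Qed.

Lemma sqsumD X t Y : sqsum X -> sqsum Y -> sqsum (X + t *: Y).
Proof.
move=> sX sY; have cXY := cvg_series_dot sX sY; rewrite /sqsum dot_comb.
exact: is_cvg_seriesD (is_cvg_seriesD sX (is_cvg_seriesZ cXY)) (is_cvg_seriesZ sY).
Qed.

Arguments sqsumD {X} t {Y}.

Lemma sqsumB X Y : sqsum X -> sqsum Y -> sqsum (X - Y).
Proof. by rewrite -scaleN1r; exact: sqsumD. Qed.

Lemma innerC X Y : inner X Y = inner Y X.
Proof. by rewrite /inner dotC. Qed.

Lemma innerDl X t Y Z : sqsum X -> sqsum Y -> sqsum Z ->
  inner (X + t *: Y) Z = inner X Z + t * inner Y Z.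
Proof.
move=> sX sY sZ; have cX := cvg_series_dot sX sZ; have cY := cvg_series_dot sY sZ.
rewrite /inner dotDl (lim_seriesD cX (is_cvg_seriesZ cY)).
by rewrite (lim_seriesZ _ cY).
Qed.

Lemma sqnorm_comb X t Y : sqsum X -> sqsum Y ->
  sqnorm (X + t *: Y) = sqnorm X + t * 2 * inner X Y + t ^+ 2 * sqnorm Y.
Proof.
move=> sX sY; have sXY := sqsumD t sX sY.
rewrite /sqnorm innerDl // (innerC X) (innerC Y) !innerDl // (innerC Y X); ring.
Qed.

Lemma sqnorm_ge0 X : sqsum X -> 0 <= sqnorm X.
Proof. by move=> sX; rewrite (le_trans _ (@series_le_lim _ _ 0 (dot_ge0 X) sX)) // /series /= big_nil. Qed.

Lemma sqr_coord_le X n i : sqsum X -> X n i ^+ 2 <= sqnorm X.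
Proof.
move=> sX; apply: le_trans (sqr_coord_le_dot X n i) _.
apply: le_trans (@series_le_lim _ _ n.+1 (dot_ge0 X) sX).
by rewrite seriesSr lerDr sumr_ge0 // => k _; apply: dot_ge0.
Qed.

Lemma sqnorm_eq0 X : sqsum X -> sqnorm X <= 0 -> X = 0.
Proof.
move=> sX X0; apply/funext => n; apply/funext => i; apply/eqP.
by rewrite -sqrf_eq0 eq_le sqr_ge0 andbT (le_trans (sqr_coord_le n i sX)).
Qed.

Lemma cauchy_schwarz X Y : sqsum X -> sqsum Y ->
  inner X Y ^+ 2 <= sqnorm X * sqnorm Y.
Proof.
move=> sX sY; have := sqnorm_ge0 sY; rewrite le_eqVlt => /orP[/eqP Y0|Y0].
  have -> : Y = 0 by apply: sqnorm_eq0 => //; rewrite -Y0.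
  have d0 Z : dot Z 0 = 0 by apply/funext => n; rewrite /dot big1 // => i _; rewrite mulr0.
  have s0 : series (0 : nat -> R) = 0.
    by apply/funext => n; rewrite /series /= big1.
  by rewrite /sqnorm /inner !d0 s0 lim_cst // expr0n mulr0.
have := sqnorm_ge0 (sqsumD (- (inner X Y / sqnorm Y)) sX sY).
rewrite sqnorm_comb //.
set a := inner _ _; set b := sqnorm Y in Y0 *; set d := sqnorm X.
have -> : d + - (a / b) * 2 * a + (- (a / b)) ^+ 2 * b = (d * b - a ^+ 2) / b.
  by field; rewrite gt_eqF.
by rewrite pmulr_lge0 ?invr_gt0 // subr_ge0.
Qed.

Lemma sqnormBC X Y : sqnorm (X - Y) = sqnorm (Y - X).
Proof.
congr (limn (series _)); apply/funext => n; apply: eq_bigr => i _.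
by rewrite !fctE -mulrNN !opprB.
Qed.

Lemma sqnormB_le X Y : sqsum X -> sqsum Y ->
  sqnorm (X - Y) <= 2 * sqnorm X + 2 * sqnorm Y.
Proof.
move=> sX sY; have := sqnorm_ge0 (sqsumD 1 sX sY).
rewrite -scaleN1r !sqnorm_comb //; lra.
Qed.

Lemma sqnorm_comb_le X t Y : sqsum X -> sqsum Y ->
  sqnorm (X + t *: Y) <= 2 * sqnorm X + 2 * t ^+ 2 * sqnorm Y.
Proof.
move=> sX sY; have := sqnorm_ge0 (sqsumD (- t) sX sY).
by rewrite !sqnorm_comb //; lra.
Qed.

(** Completeness. The Cauchy condition passes to the entries, whose limits form the
candidate; letting the second index tend to infinity in each partial sum bounds
the distance to that candidate. *)
Lemma sqnorm_complete (Z : nat -> nat -> I -> R) (e : nat -> R) :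
  e @ \oo --> 0 -> (forall m, sqsum (Z m)) ->
  (forall m k, sqnorm (Z m - Z k) <= e m + e k) ->
  exists2 L, sqsum L & forall m, sqnorm (Z m - L) <= e m.
Proof.
move=> e0 sZ Zc.
have cZ n i : cvgn (fun m => Z m n i).
  apply/cauchy_cvgP/cauchyP => eps eps0.
  have e20 : 0 < eps ^+ 2 / 2 by rewrite divr_gt0 // exprn_gt0.
  have /cvgrPdist_lt/(_ _ e20)[N _ Ne] := e0.
  exists (Z N n i); exists N => // k kN.
  have := Ne _ kN; have := Ne _ (leqnn N); rewrite /= !sub0r !normrN.
  move=> /ltr_normlW eN /ltr_normlW ek.
  rewrite /ball /= -(@ltr_pXn2r _ 2) ?nnegrE ?normr_ge0 ?ltW //.
  rewrite real_normK ?num_real //.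
  have : (Z N n i - Z k n i) ^+ 2 <= e N + e k.
    exact: le_trans (sqr_coord_le n i (sqsumB (sZ N) (sZ k))) (Zc N k).
  lra.
pose L n i := limn (fun m => Z m n i).
have ZL n i : (fun m => Z m n i) @ \oo --> L n i by exact: cZ.
have bnd m N : series (dot (Z m - L) (Z m - L)) N <= e m.
  have c1 : (fun k => series (dot (Z m - Z k) (Z m - Z k)) N) @ \oo -->
      series (dot (Z m - L) (Z m - L)) N.
    rewrite /series /=; do 2![apply: (cvg_big add_continuous) => ? _].
    by apply: cvgM; (apply: cvgB; first exact: cvg_cst); exact: ZL.
  have c2 : (fun k => e m + e k) @ \oo --> e m.
    by rewrite -[X in _ --> X]addr0; apply: cvgD => //; exact: cvg_cst.
  apply: (ler_cvg_to c1 c2); apply: nearW => k.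
  apply: le_trans (Zc m k); apply: series_le_lim (sqsumB (sZ m) (sZ k)).
  exact: dot_ge0.
have sZL m : sqsum (Z m - L) /\ sqnorm (Z m - L) <= e m.
  exact: bounded_series_cvg (dot_ge0 _) (bnd m).
exists L => [|m]; last by have [] := sZL m.
have -> : L = Z 0%N - (Z 0%N - L) by rewrite opprB addrC subrK.
by apply: sqsumB => //; have [] := sZL 0%N.
Qed.

(** A minimizing sequence for the distance from G to M is Cauchy by the parallelogram
law. The variational inequality makes its residuals nearly orthogonal to M, so
the limit residual is orthogonal to M and vanishes. *)
Lemma orthogonal_dense (M : set (nat -> I -> R)) G : sqsum G -> M !=set0 ->
  (forall X, M X -> sqsum X) -> (forall X t Y, M X -> M Y -> M (X + t *: Y)) ->
  (forall r, sqsum r -> (forall X, M X -> inner r X = 0) -> r = 0) ->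
  forall e : R, 0 < e -> exists2 X, M X & sqnorm (G - X) < e.
Proof.
move=> sG [X0 MX0] sM combM trivM e e_gt0.
have sGM X : M X -> sqsum (G - X) by move=> MX; apply: sqsumB => //; apply: sM.
pose S := [set sqnorm (G - X) | X in M].
have S_inf : has_inf S.
  split; first by exists (sqnorm (G - X0)), X0.
  by exists 0 => _ [X MX <-]; apply/sqnorm_ge0/sGM.
have infS X : M X -> inf S <= sqnorm (G - X).
  by move=> MX; apply: ge_inf; [case: S_inf | exists X].
have /choice[m mP] (j : nat) : exists X, M X /\ sqnorm (G - X) < inf S + harmonic j.
  have [_ [X MX <-] ?] := inf_adherent (harmonic_gt0 j) S_inf.
  by exists X.
have Mm j : M (m j) by case: (mP j).
have m_inf j : sqnorm (G - m j) < inf S + harmonic j by case: (mP j).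
have m_cauchy j k : sqnorm (m j - m k) <= 2 * harmonic j + 2 * harmonic k.
  have MD : M (m j - m k) by rewrite -scaleN1r; apply: combM.
  (* The midpoint of m j and m k is in M, hence at distance at least inf S from G. *)
  have h1 : inf S <= sqnorm (G - m j + (1 / 2) *: (m j - m k)).
    suff -> : G - m j + (1 / 2) *: (m j - m k) =
        G - (m j + (- (1 / 2)) *: (m j - m k)) by exact/infS/combM.
    by rewrite scaleNr opprB -addrA [- _ + _]addrC.
  have h2 : sqnorm (G - m j + 1 *: (m j - m k)) < inf S + harmonic k.
    by rewrite scale1r addrA subrK.
  have h3 := m_inf j; move: h1 h2.
  have sD := sM _ MD; have sA := sGM _ (Mm j).
  by rewrite !sqnorm_comb //; lra.
have cvgh (C : R) : (fun j => C * harmonic j) @ \oo --> 0.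
  by rewrite -(mulr0 C); apply: cvgM; [exact: cvg_cst|exact: cvg_harmonic].
have [L sL mL] : exists2 L, sqsum L & forall j, sqnorm (m j - L) <= 2 * harmonic j.
  by apply: sqnorm_complete => // j; apply: sM.
have sGL := sqsumB sG sL.
have smL j : sqsum (m j - L) by apply: sqsumB => //; apply: sM.
have GL : G - L = 0.
  apply: trivM => // X MX; have sX := sM _ MX.
  apply/eqP; rewrite -sqrf_eq0 eq_le sqr_ge0 andbT.
  have [x_le0|x_gt0] := leP (sqnorm X) 0.
    have := cauchy_schwarz sGL sX; have := sqnorm_ge0 sGL; nra.
  have orth j : inner (G - m j) X ^+ 2 <= harmonic j * sqnorm X.
    (* The optimal multiple of X; moving m j by it gains at most harmonic j. *)
    have := infS _ (combM _ (inner (G - m j) X / sqnorm X) _ (Mm j) MX).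
    have sA := sGM _ (Mm j); have := m_inf j.
    rewrite opprD addrA -scaleNr sqnorm_comb // -ler_pdivrMr //.
    set a := inner _ _; set x := sqnorm X in x_gt0 *.
    have -> : (- (a / x)) ^+ 2 * x = a ^+ 2 / x by field; rewrite gt_eqF.
    have -> : - (a / x) * 2 * a = - 2 * (a ^+ 2 / x) by field; rewrite gt_eqF.
    lra.
  have bound j : inner (G - L) X ^+ 2 <= 6 * sqnorm X * harmonic j.
    have -> : G - L = G - m j + 1 *: (m j - L) by rewrite scale1r addrA subrK.
    rewrite innerDl //; last exact: sGM.
    have := orth j; have := cauchy_schwarz (smL j) sX.
    have := ler_wpM2r (ltW x_gt0) (mL j).
    have := sqr_ge0 (inner (G - m j) X - inner (m j - L) X); nra.
  by apply: (cvgr_to_ge (cvgh (6 * sqnorm X))); apply: nearW.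
have /cvgrPdist_lt/(_ _ e_gt0)[N _ /(_ N (leqnn N))] := cvgh 2.
rewrite /= sub0r normrN => /ltr_normlW hN; exists (m N) => //.
move/subr0_eq: GL => ->; rewrite sqnormBC.
exact: le_lt_trans (mL N) hN.
Qed.

End SquareSummable.

Definition sqsum1 (R : realType) (x : nat -> R) :=
  cvgn (series (fun n => x n ^+ 2)).

Lemma sqsum_coord (R : realType) (I : finType) (X : nat -> I -> R) i : sqsum X -> sqsum1 (X^~ i).
Proof.
move=> sX; apply: series_le_cvg sX => [n|n|n]; first exact: sqr_ge0.
  exact: dot_ge0.
exact: sqr_coord_le_dot.
Qed.

Lemma cvg_series_mul (R : realType) (x y : nat -> R) : sqsum1 x -> sqsum1 y ->
  cvgn (series (fun n => x n * y n)).
Proof.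
move=> sx sy.
have D (z w : nat -> R) : dot (fun n (_ : 'I_1) => z n) (fun n _ => w n) = fun n => z n * w n.
  by apply/funext => n; rewrite /dot big_ord1.
by rewrite -D; apply: cvg_series_dot; rewrite /sqsum D.
Qed.

Section DominatedCompactness.
Variables (R : realType) (I : finType).

(** The sequences dominated by w form a product of segments, compact by Tychonoff's
theorem; a cluster point W for entrywise convergence is also one in norm, since
domination makes the tails uniformly small. *)
Lemma dominated_subsequence (V : nat -> nat -> I -> R) (w : nat -> R) :
  (forall n, 0 <= w n) -> (forall m n i, V m n i ^+ 2 <= w n) -> cvgn (series w) ->
  exists (phi : nat -> nat) (W : nat -> I -> R),
    [/\ {homo phi : m n / (m < n)%N}, (forall m, sqsum (V m - W)), sqsum W &
        (fun m => sqnorm (V (phi m) - W)) @ \oo --> 0].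
Proof.
move=> w0 Vw cw.
pose G (m : nat) : prod_topology (fun _ : nat * I => R) := fun t => V m t.1 t.2.
pose A (t : nat * I) : set R := `[- Num.sqrt (w t.1), Num.sqrt (w t.1)]%classic.
have cA : compact [set f : prod_topology (fun _ : nat * I => R) | forall t, A t (f t)].
  by apply: tychonoff => t; apply: segment_compact.
have [W0 [AW clW]] : [set f : prod_topology (fun _ : nat * I => R) | forall t, A t (f t)]
    `&` cluster (G @ \oo) !=set0.
  apply: cA; exists 0%N => // m _ t /=.
  by rewrite /A /= in_itv /= -ler_norml /G -sqrtr_sqr ler_sqrt.
pose W n i := W0 (n, i).
have Ww n i : W n i ^+ 2 <= w n.
  have := AW (n, i); rewrite /A /= in_itv /= -ler_norml.
  by rewrite -(@ler_pXn2r _ 2) ?nnegrE ?sqrtr_ge0 // sqr_sqrtr // real_normK ?num_real //.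
pose C : R := #|I|%:R.
have dom (X : nat -> I -> R) n t : (forall i, X n i ^+ 2 <= t) -> dot X X n <= C * t.
  move=> Xt; rewrite /dot /C mulr_natl -sumr_const; apply: ler_sum => i _.
  by rewrite -expr2.
have dotVW m n : dot (V m - W) (V m - W) n <= C * (4 * w n).
  apply: dom => i; have : (V m n i - W n i) ^+ 2 <= 4 * w n; last by [].
  have := Vw m n i; have := Ww n i; have := sqr_ge0 (V m n i + W n i); lra.
pose w4 := C *: (4 *: w).
have cw4 : cvgn (series w4) by do 2!apply: is_cvg_seriesZ.
have sVW m : sqsum (V m - W) := sqsum_dom (dotVW m) cw4.
have sW : sqsum W.
  have : forall n, dot W W n <= (C *: w) n by move=> n; apply: dom.
  by move/sqsum_dom; apply; apply: is_cvg_seriesZ.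
(* The head up to N0 is small by entrywise closeness, the tail by domination. *)
have freq (e : R) (m0 : nat) : 0 < e -> exists2 m, (m0 <= m)%N & sqnorm (V m - W) < e.
  move=> e0.
  have e20 : 0 < e / 2 by rewrite divr_gt0.
  have /cvgrPdist_lt/(_ _ e20)[N0 _ /(_ N0 (leqnn N0))] := cw4.
  move=> /ltr_normlW /= tail.
  pose K := N0%:R * C; have K0 : 0 <= K by rewrite mulr_ge0.
  pose eta := Num.sqrt (e / 2 / (K + 1)).
  have eta2 : 0 < e / 2 / (K + 1) by rewrite divr_gt0 // ltr_wpDl.
  have eta0 : 0 < eta by rewrite sqrtr_gt0.
  have etaP : K * eta ^+ 2 < e / 2.
    rewrite sqr_sqrtr ?(ltW eta2) // mulrCA -[ltRHS]mulr1 ltr_pM2l //.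
    by rewrite ltr_pdivrMr ?ltr_wpDl // mul1r ltrDl.
  pose P (t : 'I_N0 * I) : set (prod_topology (fun _ : nat * I => R)) :=
    [set f | `|W0 (val t.1, t.2) - f (val t.1, t.2)| < eta].
  have nP t : nbhs W0 (P t).
    have c := @proj_continuous _ (fun _ : nat * I => R : topologicalType) (val t.1, t.2) W0.
    have {}c : (fun f : prod_topology (fun _ : nat * I => R) => f (val t.1, t.2)) @ W0
      --> W0 (val t.1, t.2) := c.
    by move/cvgrPdist_lt : c; apply.
  have nB := filter_forall (nbhs_filter W0) nP.
  have nA : (G @ \oo) [set G m | m in [set m | (m0 <= m)%N]].
    by exists m0 => // m mm0; exists m.
  have [_ [[m mm0 <-] /= close]] := clW _ _ nA nB.
  exists m => //.
  have head : series (dot (V m - W) (V m - W)) N0 <= K * eta ^+ 2.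
    rewrite /series /= big_mkord -mulrA mulr_natl -[N0 in _ *+ N0]card_ord -sumr_const.
    apply: ler_sum => n _; apply: dom => i.
    have : `|W n i - V m n i| < eta := close (n, i).
    rewrite -(@ltr_pXn2r _ 2) ?nnegrE ?normr_ge0 ?(ltW eta0) //.
    rewrite real_normK ?num_real // => /ltW; apply: le_trans.
    by rewrite -[leLHS]sqrrN opprB.
  have w4_ge0 n : 0 <= w4 n by apply: le_trans (dot_ge0 _ _) (dotVW 0%N n).
  have bound N : series (dot (V m - W) (V m - W)) N <=
      K * eta ^+ 2 + (limn (series w4) - series w4 N0).
    apply: (@le_trans _ _ (series (dot (V m - W) (V m - W)) (maxn N N0))).
      by apply: nondecreasing_series; rewrite ?leq_maxl // => n _ _; apply: dot_ge0.
    have N0N : (N0 <= maxn N N0)%N by rewrite leq_maxr.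
    rewrite -[leLHS](subrK (series (dot (V m - W) (V m - W)) N0)) addrC lerD //.
    apply: (@le_trans _ _ (series w4 (maxn N N0) - series w4 N0)).
      by rewrite !sub_series_geq //; apply: ler_sum => n _; apply: dotVW.
    by rewrite lerD2r series_le_lim.
  have [_ le_bound] := bounded_series_cvg (dot_ge0 _) bound.
  apply: le_lt_trans le_bound _; lra.
have /choice[f fP] (t : nat * nat) : exists m, (t.2 <= m)%N /\ sqnorm (V m - W) < harmonic t.1.
  by have [m ? ?] := freq (harmonic t.1) t.2 (harmonic_gt0 _); exists m.
pose phi := fix phi k := if k is k'.+1 then f (k, (phi k').+1) else f (0%N, 0%N).
exists phi, W; split=> //.
  by apply: homo_ltn => [? ? ?|k]; [exact: ltn_trans|have [] := fP (k.+1, (phi k).+1)].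
apply: (@squeeze_cvgr _ _ _ _ (fun=> 0) harmonic); last 2 first.
- exact: cvg_cst.
- exact: cvg_harmonic.
apply: nearW => k; rewrite sqnorm_ge0 //=; apply: ltW.
by case: k => [|k]; [have [] := fP (0%N, 0%N)|have [] := fP (k.+1, (phi k).+1)].
Qed.

End DominatedCompactness.

(** * Scalar Jacobi matrices *)

Section ScalarJacobi.
Variables (R : realType) (a b : nat -> R).
Implicit Types x y : nat -> R.

Definition jac x : nat -> R := fun n =>
  (if n is m.+1 then b m * x m else 0) + a n * x n + b n * x n.+1.

Definition wronskian x y : nat -> R := fun n =>
  b n * (x n.+1 * y n - x n * y n.+1).

(** The diagonal terms cancel and the off-diagonal ones telescope. *)
Lemma jac_green x y N :
  series (fun n => jac x n * y n - x n * jac y n) N.+1 = wronskian x y N.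
Proof.
elim: N => [|N IH]; first by rewrite /series /= big_nat1 /jac /wronskian; ring.
by rewrite seriesSr IH /jac /wronskian; ring.
Qed.

End ScalarJacobi.

Section DiracCoefficients.
Variables (R : realType) (s ga al a b : nat -> R) (g0 c D : R).
Hypotheses (s_gt0 : forall j, 0 < s j) (s_le : forall j, s j <= D).
Hypotheses (g0_gt0 : 0 < g0) (ga_ge : forall j, g0 <= ga j) (ga_le : forall j, ga j <= c).
Hypothesis aE : forall j, a j.*2.+2 = al j.+1 / s j.+1 ^+ 2.
Hypothesis aO : forall j, a j.*2.+1 = - (ga j / s j ^+ 2).
Hypothesis bE : forall j, b j.*2 = ga j / s j ^+ 2.
Hypothesis bO : forall j, b j.*2.+1 = ga j / (s j * s j.+1).

Let s_neq0 j : s j != 0. Proof. by rewrite gt_eqF. Qed.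
Let ga_gt0 j : 0 < ga j. Proof. exact: lt_le_trans (ga_ge j). Qed.
Let c_gt0 : 0 < c. Proof. exact: lt_le_trans (ga_gt0 0) (ga_le 0). Qed.
Let D_gt0 : 0 < D. Proof. exact: lt_le_trans (s_gt0 0) (s_le 0). Qed.

(** The even rows express al x_{2j+2} and al y_{2j+2} by neighbouring odd entries.
After substitution in the Wronskian, the products x_{2j+3} y_{2j+3} cancel, and
only products of entries with different indices or of an entry with an entry of
the image are left. *)
Lemma wronskian_even x y j (X := jac a b x) (Y := jac a b y) :
  s j * s j.+1 * al j.+1 * wronskian b x y j.*2.+2 =
  ga j.+1 * (s j * s j.+1 * (x j.*2.+3 * Y j.*2.+2 - X j.*2.+2 * y j.*2.+3)
             - ga j * (x j.*2.+3 * y j.*2.+1 - x j.*2.+1 * y j.*2.+3)).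
Proof.
rewrite /X /Y /wronskian /jac aE -doubleS bE bO.
by have := s_neq0 j; have := s_neq0 j.+1 => ? ?; field; apply/andP.
Qed.

Lemma wronskian_even_le x y j (X := jac a b x) (Y := jac a b y)
    (e := fun n => x n ^+ 2 + y n ^+ 2 + X n ^+ 2 + Y n ^+ 2) :
  s j * s j.+1 * `|al j.+1| * `|wronskian b x y j.*2.+2| <=
  c * (D ^+ 2 + c) * (e j.*2.+1 + e j.*2.+2 + e j.*2.+3).
Proof.
have sj := s_gt0 j; have sj1 := s_gt0 j.+1.
rewrite -[s j * s j.+1]gtr0_norm ?mulr_gt0 // -!normrM wronskian_even.
rewrite -/X -/Y normrM (gtr0_norm (ga_gt0 _)).
pose S := e j.*2.+1 + e j.*2.+2 + e j.*2.+3; rewrite -/S.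
pose P := x j.*2.+3 * Y j.*2.+2 - X j.*2.+2 * y j.*2.+3.
pose Q := x j.*2.+3 * y j.*2.+1 - x j.*2.+1 * y j.*2.+3.
have am (p q : R) : `|p * q| <= (p ^+ 2 + q ^+ 2) / 2.
  have := sqr_ge0 (p + q); have := sqr_ge0 (p - q).
  by rewrite ler_norml => ? ?; apply/andP; split; lra.
have le_e n : [/\ 0 <= e n, x n ^+ 2 <= e n, y n ^+ 2 <= e n, X n ^+ 2 <= e n &
    Y n ^+ 2 <= e n].
  have := sqr_ge0 (x n); have := sqr_ge0 (y n).
  by have := sqr_ge0 (X n); have := sqr_ge0 (Y n); rewrite /e; split; lra.
have [? ? ? ? ?] := le_e j.*2.+1; have [? ? ? ? ?] := le_e j.*2.+2.
have [? ? ? ? ?] := le_e j.*2.+3.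
have PS : `|P| <= S.
  apply: le_trans (ler_normB _ _) _; rewrite /S.
  by have := am (x j.*2.+3) (Y j.*2.+2); have := am (X j.*2.+2) (y j.*2.+3); lra.
have QS : `|Q| <= S.
  apply: le_trans (ler_normB _ _) _; rewrite /S.
  by have := am (x j.*2.+3) (y j.*2.+1); have := am (x j.*2.+1) (y j.*2.+3); lra.
have S0 : 0 <= S by apply: le_trans PS.
rewrite -!mulrA; apply: ler_pM => //; first exact: ltW.
rewrite mulrA -/P -/Q; apply: le_trans (ler_normB _ _) _.
rewrite !normrM (gtr0_norm (ga_gt0 _)) (gtr0_norm sj) (gtr0_norm sj1) mulrDl.
apply: lerD; apply: ler_pM => //; last exact: ltW.
  by rewrite mulr_ge0 ?ltW.
by rewrite expr2; apply: ler_pM => //; exact: ltW.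
Qed.

(** Otherwise |L| / 2 times the general term of the divergent series would eventually be
dominated by the summable right-hand sides of wronskian_even_le. *)
Lemma dirac_limit_point x y (L : R) : sqsum1 x -> sqsum1 y ->
  sqsum1 (jac a b x) -> sqsum1 (jac a b y) ->
  ~ cvgn (series (fun j => s j * s j.+1 * `|al j.+1|)) ->
  wronskian b x y @ \oo --> L -> L = 0.
Proof.
move=> sx sy sX sY div WL; apply: contra_notP div => /eqP L0.
set X := jac a b x in sX *; set Y := jac a b y in sY *.
pose e n := x n ^+ 2 + y n ^+ 2 + X n ^+ 2 + Y n ^+ 2.
have e_ge0 n : 0 <= e n by rewrite !addr_ge0 ?sqr_ge0.
have ce : cvgn (series e).
  exact: is_cvg_seriesD (is_cvg_seriesD (is_cvg_seriesD sx sy) sX) sY.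
pose E j := e j.*2 + e j.*2.+1.
have E_ge0 j : 0 <= E j by rewrite addr_ge0.
have cE : cvgn (series E) by apply: cvg_series_pairs.
pose C := c * (D ^+ 2 + c).
have C0 : 0 <= C by rewrite mulr_ge0 ?addr_ge0 ?sqr_ge0 // ltW.
pose v : nat -> R := (2 / `|L| * C) *: (E + (fun j => E j.+1)).
have cv : cvgn (series v).
  apply: is_cvg_seriesZ; apply: is_cvg_seriesD => //.
  exact: cvg_series_shift.
have vE j : v j = C * (E j + E j.+1) / (`|L| / 2).
  rewrite /v; transitivity (2 / `|L| * C * (E j + E j.+1)) => //.
  by field; rewrite normr_eq0.
have L2 : 0 < `|L| / 2 by rewrite divr_gt0 ?normr_gt0.
have /cvgrPdist_lt/(_ _ L2)[N _ WN] := WL.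
apply: (@series_le_cvg_near _ _ v N) => // [n|n|j Nj].
- by rewrite !mulr_ge0 // ltW.
- by rewrite vE divr_ge0 ?(ltW L2) // mulr_ge0 // addr_ge0.
(* The index j of the series goes with the Wronskian of index 2 (j + 1). *)
have Wj : `|L| / 2 <= `|wronskian b x y j.*2.+2|.
  have jN : (N <= j.*2.+2)%N by rewrite -addnn; lia.
  have /= := WN _ jN.
  have := ler_dist_dist L (wronskian b x y j.*2.+2).
  have := ler_norm (`|L| - `|wronskian b x y j.*2.+2|); lra.
have B := wronskian_even_le x y j.
have {}B : s j * s j.+1 * `|al j.+1| * (`|L| / 2) <= C * (E j + E j.+1).
  apply: le_trans (le_trans B _).
    by rewrite ler_wpM2l // !mulr_ge0 // ltW.
  by rewrite ler_wpM2l // /E doubleS -/X -/Y -/(e _) -/(e _) -/(e _); have := e_ge0 j.*2; lra.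
by rewrite vE ler_pdivlMr.
Qed.

(** With u_j = x_{2j} / s_j and v_j = x_{2j+1} / s_j, the odd rows give v_j as u_j + u_{j+1}
up to a bounded error, and the even rows give |al_j u_j| <= c (|v_{j-1}| + |v_j|), hence
|al_j u_j| <= c (|u_{j-1}| + 2 |u_j| + |u_{j+1}|), again up to a bounded error. Where |u|
is maximal and |al_j| >= 8 c, the left-hand side absorbs half of itself. If instead
the maximum is at an index at most N, the bound on x controls it. *)
Lemma dirac_sup_bound N : (forall j, (N <= j)%N -> 8 * c <= `|al j.+1|) ->
  exists2 K, 0 <= K & forall x (E : R),
    (exists M, forall n, (M <= n)%N -> x n = 0) ->
    (forall n, `|x n| <= E) -> (forall n, `|jac a b x n| <= E) ->
    forall n, `|x n| <= K * E * s n./2.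
Proof.
move=> al_ge.
(* T * E bounds all the error terms of the even row, those of the two odd rows included. *)
pose T := (2 * c / g0 + 1) * D.
pose K1 := \sum_(0 <= i < N.+1) (s i)^-1 + T / (4 * c).
have T_ge0 : 0 <= T by rewrite mulr_ge0 ?addr_ge0 ?divr_ge0 ?mulr_ge0 ?ltW.
have sum_ge0 : 0 <= \sum_(0 <= i < N.+1) (s i)^-1.
  by apply: sumr_ge0 => i _; rewrite invr_ge0 ltW.
have Tc_ge0 : 0 <= T / (4 * c) by rewrite divr_ge0 // mulr_ge0 // ltW.
have K1_ge0 : 0 <= K1 by rewrite addr_ge0.
have Dg_ge0 : 0 <= D / g0 by rewrite divr_ge0 ?ltW.
exists (2 * K1 + D / g0) => [|x E [M xM] xE XE n]; first by lra.
pose u j := x j.*2 / s j; pose v j := x j.*2.+1 / s j.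
have E0 : 0 <= E by apply: le_trans (xE 0%N).
have vE j : v j = u j + u j.+1 - s j * jac a b x j.*2.+1 / ga j.
  rewrite /v /u /jac aO bE bO doubleS.
  have ? := s_neq0 j; have ? := s_neq0 j.+1; have ? : ga j != 0 by rewrite gt_eqF.
  by field; do ?[apply/andP; split].
have uE j : al j.+1 * u j.+1 = s j.+1 * jac a b x j.*2.+2 - ga j * v j - ga j.+1 * v j.+1.
  rewrite /v /u /jac aE bO -!doubleS bE.
  have ? := s_neq0 j; have ? := s_neq0 j.+1.
  by field; do ?[apply/andP; split].
have sXE j m : `|s j * jac a b x m| <= D * E.
  by rewrite normrM gtr0_norm //; apply: ler_pM => //; exact: ltW.
have v_le j : `|v j| <= `|u j| + `|u j.+1| + D * E / g0.
  rewrite vE (le_trans (ler_normB _ _)) // lerD ?ler_normD //.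
  rewrite normrM normfV (gtr0_norm (ga_gt0 _)) ler_pM ?invr_ge0 ?(ltW (ga_gt0 _)) //.
  by rewrite lef_pV2 ?posrE.
have [k kmax] : exists k, forall j, `|u j| <= `|u k|.
  apply: (@exists_max_norm _ _ M) => j Mj; rewrite /u xM ?mul0r //.
  by rewrite (leq_trans Mj) // -addnn leq_addr.
have u_le j : `|u j| <= K1 * E.
  apply: le_trans (kmax j) _.
  have [kN|] := leqP k N.
    rewrite /u normrM normfV (gtr0_norm (s_gt0 _)) mulrC ler_pM ?invr_ge0 ?(ltW (s_gt0 _)) //.
    rewrite /K1 big_mkord (bigD1 (Ordinal (kN : (k < N.+1)%N))) //= -addrA lerDl.
    by rewrite addr_ge0 // sumr_ge0 // => i _; rewrite invr_ge0 ltW.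
  case: k kmax => [//|k] kmax; rewrite ltnS => /al_ge al8.
  suff : 4 * c * `|u k.+1| <= T * E.
    rewrite -ler_pdivlMl ?mulr_gt0 // => /le_trans -> //.
    by rewrite mulrC mulrAC ler_wpM2r // lerDr.
  have : 8 * c * `|u k.+1| <= `|al k.+1 * u k.+1|.
    by rewrite [leRHS]normrM; exact: ler_wpM2r.
  have cM z w : z <= w -> c * z <= c * w by rewrite ler_pM2l.
  have gM i : `|ga i * v i| <= c * `|v i|.
    by rewrite (normrM (ga i)) (gtr0_norm (ga_gt0 _)); exact: ler_wpM2r.
  have := le_trans (gM k) (cM _ _ (v_le k)).
  have := le_trans (gM k.+1) (cM _ _ (v_le k.+1)).
  have := cM _ _ (kmax k); have := cM _ _ (kmax k.+2); have := sXE k.+1 k.*2.+2.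
  have := ler_normB (s k.+1 * jac a b x k.*2.+2 - ga k * v k) (ga k.+1 * v k.+1).
  have := ler_normB (s k.+1 * jac a b x k.*2.+2) (ga k * v k).
  rewrite uE /T; have -> : (2 * c / g0 + 1) * D * E = 2 * c * (D * E / g0) + D * E.
    by field; rewrite gt_eqF.
  lra.
have KE : K1 * E <= (2 * K1 + D / g0) * E by rewrite ler_wpM2r //; lra.
have -> : x n = (if odd n then v n./2 else u n./2) * s n./2.
  rewrite -[n in LHS]odd_double_half /u /v; case: odd => /=;
  by rewrite divfK.
rewrite normrM (gtr0_norm (s_gt0 _)) ler_wpM2r ?(ltW (s_gt0 _)) //.
case: odd; last exact: le_trans (u_le _) KE.
by have := u_le n./2; have := u_le n./2.+1; have := v_le n./2; lra.
Qed.

End DiracCoefficients.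

(** * Sums of real Jacobi matrices on complexified sequences *)

Section RealBlockJacobi.
Variables (R : realType) (K : finType) (a : K -> nat -> R) (b : nat -> R).
Let I : finType := (K * bool)%type.
Implicit Types X Y Z : nat -> I -> R.

Definition jacs X : nat -> I -> R := fun n i => jac (a i.1) b (X^~ i) n.

(** The coordinate (k, false) is the real part and (k, true) the imaginary part of the
k-th component; this is multiplication by i. *)
Definition mul_i X : nat -> I -> R := fun n i =>
  if i.2 then X n (i.1, false) else - X n (i.1, true).

(** The domain of the maximal operator, the adjoint of the minimal one. *)
Definition max_domain X := sqsum X /\ sqsum (jacs X).

Definition finsupp X := exists N, forall n, (N <= n)%N -> X n = 0.

Lemma jacs_comb X t Y : jacs (X + t *: Y) = jacs X + t *: jacs Y.
Proof.
apply/funext => n; apply/funext => i.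
transitivity (jacs X n i + t * jacs Y n i) => //.
rewrite /jacs /jac; case: n => [|n].
  rewrite (_ : (X + t *: Y) 0%N i = X 0%N i + t * Y 0%N i) //.
  by rewrite (_ : (X + t *: Y) 1%N i = X 1%N i + t * Y 1%N i) //; ring.
rewrite !(_ : forall m, (X + t *: Y) m i = X m i + t * Y m i) //; ring.
Qed.

Lemma jacsB X Y : jacs (X - Y) = jacs X - jacs Y.
Proof. by rewrite -[- Y]scaleN1r jacs_comb scaleN1r. Qed.

Lemma mul_i_comb X t Y : mul_i (X + t *: Y) = mul_i X + t *: mul_i Y.
Proof.
apply/funext => n; apply/funext => -[k []].
  by transitivity (X n (k, false) + t * Y n (k, false)).
transitivity (- (X n (k, true) + t * Y n (k, true))) => //.
by transitivity (- X n (k, true) + t * - Y n (k, true)) => //; ring.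
Qed.

Lemma mul_iB X Y : mul_i (X - Y) = mul_i X - mul_i Y.
Proof. by rewrite -[- Y]scaleN1r mul_i_comb scaleN1r. Qed.

Lemma jacs_mul_i X : jacs (mul_i X) = mul_i (jacs X).
Proof.
apply/funext => n; apply/funext => -[k []] //.
by rewrite /jacs /mul_i /= /jac /=; case: n => [|n]; ring.
Qed.

Lemma sum_pair_bool (F : I -> R) : \sum_i F i = \sum_k (F (k, false) + F (k, true)).
Proof.
rewrite (eq_bigr (fun i => F (i.1, i.2))); last by case.
rewrite -(pair_big xpredT xpredT (fun k c => F (k, c))) /=.
by apply: eq_bigr => k _; rewrite big_bool addrC.
Qed.

Lemma dot_mul_i X Y : dot (mul_i X) (mul_i Y) = dot X Y.
Proof.
by apply/funext => n; rewrite /dot !sum_pair_bool; apply: eq_bigr => k _; rewrite /mul_i /=; ring.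
Qed.

Lemma dot_mul_iC X Y n : dot X (mul_i Y) n = - dot (mul_i X) Y n.
Proof.
rewrite /dot !sum_pair_bool -sumrN; apply: eq_bigr => k _; rewrite /mul_i /=; ring.
Qed.

Lemma sqsum_mul_i X : sqsum X -> sqsum (mul_i X).
Proof. by rewrite /sqsum dot_mul_i. Qed.

Lemma sqnorm_mul_i X : sqnorm (mul_i X) = sqnorm X.
Proof. by rewrite /sqnorm /inner dot_mul_i. Qed.

Lemma inner_mul_iC X Y : sqsum X -> sqsum Y -> inner X (mul_i Y) = - inner (mul_i X) Y.
Proof.
move=> sX sY; rewrite /inner (_ : dot X (mul_i Y) = - dot (mul_i X) Y).
  by rewrite lim_seriesN //; apply: cvg_series_dot => //; apply: sqsum_mul_i.
by apply/funext => n; rewrite dot_mul_iC.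
Qed.

Lemma inner_finite X Y N : (forall n, (N <= n)%N -> dot X Y n = 0) ->
  cvgn (series (dot X Y)) /\ inner X Y = series (dot X Y) N.
Proof.
move=> XY0.
have c : series (dot X Y) @ \oo --> series (dot X Y) N.
  apply: cvg_near_cst; exists N => // n /= Nn; apply/eqP.
  rewrite -subr_eq0 sub_series_geq // big_nat_cond big1 // => k /andP[/andP[Nk _] _].
  exact: XY0.
split; first by apply/cvg_ex; exists (series (dot X Y) N).
exact: cvg_lim.
Qed.

Lemma dot_supp X Y n : Y n = 0 -> dot X Y n = 0.
Proof. by move=> Y0; rewrite /dot big1 // => i _; rewrite Y0 /= mulr0. Qed.

Lemma sqnorm0 : sqnorm (0 : nat -> I -> R) = 0.
Proof.
have [_] := @inner_finite 0 0 0%N (fun n _ => dot_supp 0 erefl).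
by rewrite /sqnorm => ->; rewrite /series /= big_geq.
Qed.

Lemma sqsum_finsupp X : finsupp X -> sqsum X.
Proof.
by case=> N X0; apply: (inner_finite (N := N) _).1 => n /X0/dot_supp.
Qed.

Lemma jacs_supp X N : (forall n, (N <= n)%N -> X n = 0) ->
  forall n, (N.+1 <= n)%N -> jacs X n = 0.
Proof.
move=> X0 [//|n] Nn; apply/funext => i; rewrite /jacs /jac.
by rewrite !X0 /= ?mulr0 ?addr0 // ltnW // ltnW.
Qed.

Lemma finsupp_jacs X : finsupp X -> finsupp (jacs X).
Proof. by case=> N X0; exists N.+1; apply: jacs_supp. Qed.

Lemma finsupp_mul_i X : finsupp X -> finsupp (mul_i X).
Proof.
case=> N X0; exists N => n /X0 Xn.
by apply/funext => -[k []]; rewrite /mul_i /= Xn //= oppr0.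
Qed.

Lemma finsupp_comb X t Y : finsupp X -> finsupp Y -> finsupp (X + t *: Y).
Proof.
case=> N X0 [M Y0]; exists (maxn N M) => n; rewrite geq_max => /andP[/X0 Xn /Y0 Yn].
by rewrite (_ : (X + t *: Y) n = X n + t *: Y n) // Xn Yn scaler0 addr0.
Qed.

Lemma finsuppB X Y : finsupp X -> finsupp Y -> finsupp (X - Y).
Proof. by rewrite -scaleN1r; exact: finsupp_comb. Qed.

Lemma max_domain_finsupp X : finsupp X -> max_domain X.
Proof. by move=> fX; split; apply: sqsum_finsupp => //; apply: finsupp_jacs. Qed.

Lemma max_domainB X Y : max_domain X -> max_domain Y -> max_domain (X - Y).
Proof. by case=> ? ? [? ?]; split; rewrite ?jacsB; apply: sqsumB. Qed.

Lemma series_green X Y N :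
  series (dot (jacs X) Y) N.+1 - series (dot X (jacs Y)) N.+1 =
  \sum_i wronskian b (X^~ i) (Y^~ i) N.
Proof.
rewrite -(eq_bigr _ (fun i _ => jac_green (a i.1) b (X^~ i) (Y^~ i) N)).
rewrite /series /= -sumrB exchange_big /=; apply: eq_bigr => n _.
by rewrite -sumrB.
Qed.

(** Symmetry against finitely supported sequences holds for arbitrary X: the
Wronskians vanish far enough. *)
Lemma inner_jacs_finsupp X Y : finsupp Y -> inner X (jacs Y) = inner (jacs X) Y.
Proof.
case=> N Y0.
have [_ ->] := @inner_finite X (jacs Y) N.+2 (fun n Nn => dot_supp X (jacs_supp Y0 (ltnW Nn))).
have [_ ->] := @inner_finite (jacs X) Y N.+2 (fun n Nn => dot_supp _ (Y0 n (ltnW (ltnW Nn)))).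
apply/esym/eqP; rewrite -subr_eq0 series_green big1 // => i _.
by rewrite /wronskian !Y0 //= ?mulr0 ?subrr ?mulr0 // ltnW.
Qed.

Definition delta (n0 : nat) (i0 : I) : nat -> I -> R :=
  fun n i => ((n == n0) && (i == i0))%:R.

Lemma finsupp_delta n0 i0 : finsupp (delta n0 i0).
Proof.
by exists n0.+1 => n nn0; apply/funext => i; rewrite /delta gtn_eqF.
Qed.

Lemma inner_delta X n0 i0 : inner X (delta n0 i0) = X n0 i0.
Proof.
have [_ ->] : cvgn (series (dot X (delta n0 i0))) /\
    inner X (delta n0 i0) = series (dot X (delta n0 i0)) n0.+1.
  by apply: inner_finite => n nn0; rewrite /dot big1 // => i _; rewrite /delta gtn_eqF //= mulr0.
rewrite seriesSr /series /= big_nat_cond big1 ?add0r => [|n /andP[/andP[_ nn0] _]]; last first.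
  by rewrite /dot big1 // => i _; rewrite /delta ltn_eqF //= mulr0.
rewrite /dot (bigD1 i0) //= /delta !eqxx mulr1 big1 ?addr0 // => i /negPf ii0.
by rewrite ii0 andbF mulr0.
Qed.

Lemma finsupp_dense G (e : R) : sqsum G -> 0 < e ->
  exists2 X, finsupp X & sqnorm (G - X) < e.
Proof.
move=> sG e0; pose M : set (nat -> I -> R) := finsupp.
apply: (@orthogonal_dense _ _ M) => //.
- by exists 0, 0%N.
- by move=> X; apply: sqsum_finsupp.
- by move=> X t Y; apply: finsupp_comb.
move=> r _ r0; apply/funext => n; apply/funext => i.
by rewrite -(inner_delta r n i) r0 //; apply: finsupp_delta.
Qed.

Lemma cvg_coord (Z : nat -> nat -> I -> R) L (e : nat -> R) :
  e @ \oo --> 0 -> (forall m, sqsum (Z m - L)) -> (forall m, sqnorm (Z m - L) <= e m) ->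
  forall n i, (fun m => Z m n i) @ \oo --> L n i.
Proof.
move=> e0 sZ Ze n i; apply/cvgrPdist_lt => d d0.
have d20 : 0 < d ^+ 2 by rewrite exprn_gt0.
have /cvgrPdist_lt/(_ _ d20)[N _ Ne] := e0; exists N => // m Nm /=.
rewrite distrC -(@ltr_pXn2r _ 2) ?nnegrE ?normr_ge0 ?ltW // real_normK ?num_real //.
have : (Z m n i - L n i) ^+ 2 <= e m := le_trans (sqr_coord_le n i (sZ m)) (Ze m).
by have := Ne _ Nm; rewrite /= sub0r normrN => /ltr_normlW; lra.
Qed.

Lemma cvg_jacs_coord (Z : nat -> nat -> I -> R) L :
  (forall n i, (fun m => Z m n i) @ \oo --> L n i) ->
  forall n i, (fun m => jacs (Z m) n i) @ \oo --> jacs L n i.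
Proof.
move=> ZL n i; rewrite /jacs /jac; apply: cvgD; [apply: cvgD|].
- case: n => [|n]; first exact: cvg_cst.
  by apply: cvgM => //; exact: cvg_cst.
- by apply: cvgM => //; exact: cvg_cst.
- by apply: cvgM => //; exact: cvg_cst.
Qed.

Lemma cvg_mul_i_coord (Z : nat -> nat -> I -> R) L :
  (forall n i, (fun m => Z m n i) @ \oo --> L n i) ->
  forall n i, (fun m => mul_i (Z m) n i) @ \oo --> mul_i L n i.
Proof. by move=> ZL n [k []]; rewrite /mul_i /=; [exact: ZL|apply: cvgN; exact: ZL]. Qed.

(** The pair (F, H) is in the closure of the graph of the matrix restricted to finitely
supported sequences. *)
Definition in_graph_closure F H := forall e : R, 0 < e ->
  exists2 X, finsupp X & sqnorm (F - X) < e /\ sqnorm (H - jacs X) < e.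

(** Norm convergence implies entrywise convergence, for which the matrix is
continuous as its rows are finite. *)
Lemma graph_closure_jacs F H : sqsum F -> sqsum H -> in_graph_closure F H -> H = jacs F.
Proof.
move=> sF sH FH.
have /choice[Z ZP] (m : nat) : exists X, finsupp X /\
    (sqnorm (X - F) <= harmonic m /\ sqnorm (jacs X - H) <= harmonic m).
  have [X fX [/ltW h1 /ltW h2]] := FH _ (harmonic_gt0 m).
  by exists X; split=> //; rewrite sqnormBC [X in _ /\ X <= _]sqnormBC.
have sZ m : sqsum (Z m) /\ sqsum (jacs (Z m)).
  by apply: max_domain_finsupp; case: (ZP m).
apply/funext => n; apply/funext => i.
have cH : (fun m => jacs (Z m) n i) @ \oo --> H n i.
  apply: (@cvg_coord (fun m => jacs (Z m)) H harmonic) => [|m|m].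
  + exact: cvg_harmonic.
  + by apply: sqsumB => //; case: (sZ m).
  + by case: (ZP m) => _ [].
rewrite -(cvg_lim (@Rhausdorff R) cH); apply: cvg_lim => //.
apply: cvg_jacs_coord; apply: (@cvg_coord Z F harmonic) => [|m|m].
- exact: cvg_harmonic.
- by apply: sqsumB => //; case: (sZ m).
- by case: (ZP m) => _ [].
Qed.

Hypothesis limit_point : forall k (x y : nat -> R) (L : R), sqsum1 x -> sqsum1 y ->
  sqsum1 (jac (a k) b x) -> sqsum1 (jac (a k) b y) ->
  wronskian b x y @ \oo --> L -> L = 0.

(** The boundary terms at infinity are the limits of the Wronskians of the components. *)
Lemma green X Y : max_domain X -> max_domain Y -> inner (jacs X) Y = inner X (jacs Y).
Proof.
move=> [sX sJX] [sY sJY].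
have c1 : (fun N => series (dot (jacs X) Y) N.+1 - series (dot X (jacs Y)) N.+1) @ \oo -->
   inner (jacs X) Y - inner X (jacs Y).
  apply: cvgB.
    by rewrite (cvg_shiftS (series (dot (jacs X) Y))); apply: cvg_series_dot.
  by rewrite (cvg_shiftS (series (dot X (jacs Y)))); apply: cvg_series_dot.
have c2 : (fun N => \sum_i wronskian b (X^~ i) (Y^~ i) N) @ \oo --> \sum_(i : I) (0 : R).
  apply: (cvg_big add_continuous) => i _.
  have sx := sqsum_coord (i := i) sX; have sy := sqsum_coord (i := i) sY.
  have sJx : sqsum1 (jac (a i.1) b (X^~ i)) by apply: (sqsum_coord (i := i) sJX).
  have sJy : sqsum1 (jac (a i.1) b (Y^~ i)) by apply: (sqsum_coord (i := i) sJY).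
  have cW := is_cvg_seriesB (cvg_series_mul sJx sy) (cvg_series_mul sx sJy).
  have {}cW : wronskian b (X^~ i) (Y^~ i) @ \oo -->
      limn (series ((fun n => jac (a i.1) b (X^~ i) n * Y n i)
                    - (fun n => X n i * jac (a i.1) b (Y^~ i) n))).
    have -> : wronskian b (X^~ i) (Y^~ i) = fun N => series
        (fun n => jac (a i.1) b (X^~ i) n * Y n i - X n i * jac (a i.1) b (Y^~ i) n) N.+1.
      by apply/funext => N; rewrite jac_green.
    by rewrite (cvg_shiftS (series _)).
  by rewrite -[X in _ --> X](limit_point sx sy sJx sJy cW).
have E : (fun N => series (dot (jacs X) Y) N.+1 - series (dot X (jacs Y)) N.+1) =
    (fun N => \sum_i wronskian b (X^~ i) (Y^~ i) N).
  by apply/funext => N; exact: series_green.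
rewrite E big1_eq in c1 c2.
apply/eqP; rewrite -subr_eq0; apply/eqP.
by rewrite -(cvg_lim (@Rhausdorff R) c1) (cvg_lim (@Rhausdorff R) c2).
Qed.

(** Symmetry of J, antisymmetry of i and their commutation make this number its own
opposite. *)
Lemma inner_jacs_mul_i X : max_domain X -> inner (jacs X) (mul_i X) = 0.
Proof.
move=> DX; have [sX sJX] := DX.
have DrX : max_domain (mul_i X) by split; rewrite ?jacs_mul_i; apply: sqsum_mul_i.
have := green DX DrX; rewrite jacs_mul_i (inner_mul_iC sX sJX) (innerC (mul_i X)); lra.
Qed.

Lemma sqnorm_jacs_mul_i X t : max_domain X ->
  sqnorm (jacs X + t *: mul_i X) = sqnorm (jacs X) + t ^+ 2 * sqnorm X.
Proof.
move=> DX; have [sX sJX] := DX.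
rewrite sqnorm_comb //; last exact: sqsum_mul_i.
by rewrite inner_jacs_mul_i // mulr0 addr0 sqnorm_mul_i.
Qed.

Lemma jacs_mul_i_inj X t : t != 0 -> max_domain X -> jacs X + t *: mul_i X = 0 -> X = 0.
Proof.
move=> t0 DX E; have [sX sJX] := DX; apply: sqnorm_eq0 => //.
have t2 : 0 < t ^+ 2 by rewrite exprn_even_gt0.
have := sqnorm_ge0 sJX; have := sqnorm_jacs_mul_i t DX; rewrite E sqnorm0.
by rewrite -(pmulr_rle0 _ t2); lra.
Qed.

(** Testing orthogonality of r on unit vectors gives J r + i r = 0. In particular J r is
square-summable, so r is in the maximal domain, where J + i is injective. *)
Lemma jacs_mul_i_dense G (e : R) : sqsum G -> 0 < e ->
  exists2 X, finsupp X & sqnorm (G - (jacs X - mul_i X)) < e.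
Proof.
move=> sG e0.
pose M : set (nat -> I -> R) := [set jacs X - mul_i X | X in finsupp].
suff [_ [X fX <-] ?] : exists2 Y, M Y & sqnorm (G - Y) < e by exists X.
apply: orthogonal_dense => //.
- by exists (jacs 0 - mul_i 0), 0 => //; exists 0%N.
- move=> _ [X fX <-]; apply: sqsum_finsupp; apply: finsuppB.
    exact: finsupp_jacs.
  exact: finsupp_mul_i.
- move=> _ t _ [X fX <-] [Y fY <-]; exists (X + t *: Y).
    exact: finsupp_comb.
  by rewrite jacs_comb mul_i_comb scalerBr opprD addrACA.
move=> r sr rM.
have E : jacs r + 1 *: mul_i r = 0.
  apply/funext => n; apply/funext => i; rewrite scale1r.
  have fd := finsupp_delta n i.
  have := rM _ (ex_intro2 _ _ _ fd erefl).
  rewrite innerC -scaleN1r innerDl //; last first.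
  + exact/sqsum_finsupp/finsupp_mul_i.
  + exact/sqsum_finsupp/finsupp_jacs.
  rewrite innerC inner_jacs_finsupp // inner_delta innerC inner_mul_iC //; last exact: sqsum_finsupp.
  by rewrite inner_delta mulrNN mul1r.
apply: (@jacs_mul_i_inj r 1) => //; split=> //.
have -> : jacs r = 0 - mul_i r by apply: (canRL (addrK _)); rewrite -E scale1r.
apply: sqsumB; last exact: sqsum_mul_i.
by apply: sqsum_finsupp; exists 0%N.
Qed.

(** If (J - i) Z_m tends to G, the identity for |J Z - i Z|^2 makes both Z_m and J Z_m
Cauchy, and their limits form a point of the closed graph. *)
Lemma jacs_mul_i_surj G : sqsum G ->
  exists F, [/\ max_domain F, in_graph_closure F (jacs F) & jacs F - mul_i F = G].
Proof.
move=> sG.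
have /choice[Z ZP] (m : nat) : exists X, finsupp X /\ sqnorm (G - (jacs X - mul_i X)) < harmonic m.
  by have [X fX h1] := jacs_mul_i_dense sG (harmonic_gt0 m); exists X.
have DZ m : max_domain (Z m) by apply: max_domain_finsupp; case: (ZP m).
have cauchyZ m k : sqnorm (jacs (Z m) - jacs (Z k)) + sqnorm (Z m - Z k) <=
    2 * harmonic m + 2 * harmonic k.
  have := sqnorm_jacs_mul_i (-1) (max_domainB (DZ m) (DZ k)).
  have E : jacs (Z m - Z k) + (-1) *: mul_i (Z m - Z k) =
      (G - (jacs (Z k) - mul_i (Z k))) - (G - (jacs (Z m) - mul_i (Z m))).
    rewrite scaleN1r jacsB mul_iB; apply/funext => n; apply/funext => i.
    by rewrite !fctE; ring.
  have sS j : sqsum (G - (jacs (Z j) - mul_i (Z j))).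
    by case: (DZ j) => *; do 2![apply: sqsumB => //]; apply: sqsum_mul_i.
  have := sqnormB_le (sS k) (sS m); rewrite E jacsB.
  by have [_] := ZP m; have [_] := ZP k; lra.
have h2 : (fun j => 2 * harmonic j) @ \oo --> (0 : R).
  by rewrite -(mulr0 2); apply: cvgM; [exact: cvg_cst|exact: cvg_harmonic].
have [F sF FZ] : exists2 F, sqsum F & forall m, sqnorm (Z m - F) <= 2 * harmonic m.
  apply: sqnorm_complete => // [m|m k]; first by case: (DZ m).
  apply: le_trans (cauchyZ m k); rewrite lerDr; apply: sqnorm_ge0.
  by apply: sqsumB; [case: (DZ m)|case: (DZ k)].
have [H sH HZ] : exists2 F, sqsum F & forall m, sqnorm (jacs (Z m) - F) <= 2 * harmonic m.
  apply: sqnorm_complete => // [m|m k]; first by case: (DZ m).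
  apply: le_trans (cauchyZ m k); rewrite lerDl; apply: sqnorm_ge0.
  by apply: sqsumB; [case: (DZ m)|case: (DZ k)].
have apx : in_graph_closure F H.
  move=> e e0; have /cvgrPdist_lt/(_ _ e0)[N _ /(_ N (leqnn N))] := h2.
  rewrite /= sub0r normrN => /ltr_normlW hN; exists (Z N); first by case: (ZP N).
  by split; rewrite sqnormBC; apply: le_lt_trans hN.
have HF := graph_closure_jacs sF sH apx; subst H.
exists F; split=> //.
have cF := cvg_coord h2 (fun m => sqsumB (DZ m).1 sF) FZ.
have cG := @cvg_coord (fun m => jacs (Z m) - mul_i (Z m)) G harmonic cvg_harmonic.
apply/funext => n; apply/funext => i.
have {}cG : (fun m => jacs (Z m) n i - mul_i (Z m) n i) @ \oo --> G n i.
  apply: cG => m.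
    by case: (DZ m) => *; do 2![apply: sqsumB => //]; apply: sqsum_mul_i.
  by rewrite sqnormBC ltW //; case: (ZP m).
rewrite -(cvg_lim (@Rhausdorff R) cG); apply/esym/cvg_lim => //.
by apply: cvgB; [apply: cvg_jacs_coord|apply: cvg_mul_i_coord].
Qed.

Lemma jacs_mul_i_unique X Y : max_domain X -> max_domain Y ->
  jacs X - mul_i X = jacs Y - mul_i Y -> X = Y.
Proof.
move=> DX DY E; apply: subr0_eq.
apply: (@jacs_mul_i_inj _ (-1)); rewrite ?oppr_eq0 ?oner_eq0 //; first exact: max_domainB.
rewrite scaleN1r jacsB mul_iB; apply/funext => n; apply/funext => i.
have En : jacs X n i - mul_i X n i = jacs Y n i - mul_i Y n i := congr1 (fun Z => Z n i) E.
by suff : jacs X n i - jacs Y n i - (mul_i X n i - mul_i Y n i) = 0 by []; lra.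
Qed.

(** The minimal operator is maximal: J - i is already onto on the closure of the finitely
supported graph, and it is injective on the maximal domain. *)
Theorem max_domain_graph_closure F : max_domain F -> in_graph_closure F (jacs F).
Proof.
move=> DF; have [sF sJF] := DF.
have [F' [DF' aF' E]] := jacs_mul_i_surj (sqsumB sJF (sqsum_mul_i sF)).
by rewrite -(jacs_mul_i_unique DF' DF E).
Qed.

End RealBlockJacobi.

(** * Block Jacobi operators with real diagonal entries *)

Section RealPicture.
Variables (R : realType) (p : nat).
Local Open Scope complex_scope.
Implicit Types (f g : vseq R p).

Definition coords f : nat -> ('I_p * bool)%type -> R := fun n i =>
  if i.2 then complex.Im (f n i.1 0) else complex.Re (f n i.1 0).

Definition of_coords (X : nat -> ('I_p * bool)%type -> R) : vseq R p := fun n =>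
  \col_k (X n (k, false) +i* X n (k, true)).

Lemma of_coordsK X : coords (of_coords X) = X.
Proof. by apply/funext => n; apply/funext => -[k []]; rewrite /coords /of_coords /= mxE. Qed.

Lemma coordsK f : of_coords (coords f) = f.
Proof.
apply/funext => n; apply/matrixP => k j; rewrite mxE (ord1 j) /coords /=.
by case: (f n k 0).
Qed.

Lemma coordsB f g : coords (fun n => f n - g n) = coords f - coords g.
Proof.
apply/funext => n; apply/funext => -[k []].
  transitivity (complex.Im (f n k 0) - complex.Im (g n k 0)) => //.
  by rewrite /coords /= !mxE; case: (f n k 0) => ? ?; case: (g n k 0).
transitivity (complex.Re (f n k 0) - complex.Re (g n k 0)) => //.
by rewrite /coords /= !mxE; case: (f n k 0) => ? ?; case: (g n k 0).
Qed.

Lemma coords_shift g f (z : R[i]) : coords (fun n => g n + z *: f n) =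
  coords g + (complex.Re z *: coords f + complex.Im z *: mul_i (coords f)).
Proof.
apply/funext => n; apply/funext => -[k []].
  transitivity (complex.Im (g n k 0) + (complex.Re z * complex.Im (f n k 0)
      + complex.Im z * complex.Re (f n k 0))) => //.
  rewrite /coords /= !mxE; case: (f n k 0) => ? ?; case: (g n k 0) => ? ?; case: z => ? ? /=; ring.
transitivity (complex.Re (g n k 0) + (complex.Re z * complex.Re (f n k 0)
      + complex.Im z * - complex.Im (f n k 0))) => //.
rewrite /coords /= !mxE; case: (f n k 0) => ? ?; case: (g n k 0) => ? ?; case: z => ? ? /=; ring.
Qed.

Lemma dot_coords f g n : dot (coords f) (coords g) n =
  \sum_(k < p) (complex.Re (f n k 0) * complex.Re (g n k 0)
    + complex.Im (f n k 0) * complex.Im (g n k 0)).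
Proof. by rewrite /dot sum_pair_bool. Qed.

Lemma l2norm_sq_coords f : l2norm_sq f = (\sum_(0 <= n <oo) (dot (coords f) (coords f) n)%:E)%E.
Proof.
rewrite /l2norm_sq; congr (limn _); apply/funext => N; apply: eq_bigr => n _.
by rewrite dot_coords; congr EFin; apply: eq_bigr => k _; rewrite !expr2.
Qed.

Lemma l2norm_sqE f : sqsum (coords f) -> l2norm_sq f = (sqnorm (coords f))%:E.
Proof.
move=> sf; rewrite l2norm_sq_coords /sqnorm /inner -EFin_lim //.
by congr (limn _); apply/funext => N; rewrite /series /= sumEFin.
Qed.

Lemma l2E f : l2 f <-> sqsum (coords f).
Proof.
split=> [|sf]; last by rewrite /l2 /= l2norm_sqE // ltry.
by rewrite /l2 /= l2norm_sq_coords; apply: nnseries_is_cvg => n; apply: dot_ge0.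
Qed.

Lemma l2dist_sqE f g : sqsum (coords f) -> sqsum (coords g) ->
  l2dist_sq f g = (sqnorm (coords f - coords g))%:E.
Proof. by move=> sf sg; rewrite /l2dist_sq l2norm_sqE coordsB //; apply: sqsumB. Qed.

(** The imaginary part of the product of f and the conjugate of g is the real part of
the product of f and the conjugate of i g. *)
Lemma l2innerE f g :
  l2inner f g = inner (coords f) (coords g) +i* inner (coords f) (mul_i (coords g)).
Proof.
rewrite /l2inner /inner; congr (limn (series _) +i* limn (series _)).
  apply/funext => n; rewrite dot_coords raddf_sum /=; apply: eq_bigr => k _.
  by case: (f n k 0) => ? ?; case: (g n k 0) => ? ? /=; ring.
apply/funext => n; rewrite raddf_sum /= /dot sum_pair_bool; apply: eq_bigr => k _.
by rewrite /mul_i /coords /=; case: (f n k 0) => ? ?; case: (g n k 0) => ? ? /=; ring.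
Qed.

Lemma finitely_supportedE f : finitely_supported f <-> finsupp (coords f).
Proof.
split=> -[N f0]; exists N => n /f0 fn.
  by apply/funext => -[k []]; rewrite /coords /= fn mxE.
apply/matrixP => k j; rewrite (ord1 j) mxE.
have := congr1 (fun u => u (k, false)) fn; have := congr1 (fun u => u (k, true)) fn.
rewrite /coords /=; case: (f n k 0) => u v /= -> -> //.
Qed.

Variables (A B : nat -> 'M[R[i]]_p) (a : 'I_p -> nat -> R) (b : nat -> R).
Hypothesis AE : forall n, A n = diag_mx (\row_k (a k n)%:C).
Hypothesis BE : forall n, B n = (b n)%:C%:M.

Lemma jacobi_action_entry f n k : jacobi_action A B f n k 0 =
  (if n is m.+1 then (b m)%:C * f m k 0 else 0) + (a k n)%:C * f n k 0
  + (b n)%:C * f n.+1 k 0.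
Proof.
rewrite /jacobi_action AE BE mul_diag_mx mul_scalar_mx !mxE; congr (_ + _ * _ + _).
case: n => [|m]; first by rewrite mxE.
have -> : map_mx conjc (B m)^T = (b m)%:C%:M.
  by apply/matrixP => i j; rewrite BE !mxE eq_sym; case: eqP => _; rewrite /= ?oppr0.
by rewrite mul_scalar_mx mxE.
Qed.

Lemma coords_jacobi f : coords (jacobi_action A B f) = jacs a b (coords f).
Proof.
apply/funext => n; apply/funext => -[k c].
rewrite /jacs /jac /coords /= jacobi_action_entry; case: c;
case: n => [|n]; rewrite ?add0r; case: (f _ k 0) => ? ?; case: (f _ k 0) => ? ?;
  try case: (f _ k 0) => ? ?; rewrite /=; ring.
Qed.

Hypothesis limit_point : forall k (x y : nat -> R) (L : R), sqsum1 x -> sqsum1 y ->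
  sqsum1 (jac (a k) b x) -> sqsum1 (jac (a k) b y) ->
  wronskian b x y @ \oo --> L -> L = 0.

Let T := minimal_jacobi A B.

Lemma minimal_jacobiE f g :
  T (f, g) <-> max_domain a b (coords f) /\ coords g = jacs a b (coords f).
Proof.
split=> [[/= /l2E sf /l2E sg cl]|[[sf sJf] gE]].
  suff gE : coords g = jacs a b (coords f) by split=> //; split=> //; rewrite -gE.
  apply: graph_closure_jacs => // e /cl[[h k] [/= /finitely_supportedE fh -> [d1 d2]]].
  have [sh sJh] := max_domain_finsupp a b fh.
  exists (coords h) => //; rewrite -coords_jacobi in sJh *.
  by rewrite -!lte_fin -!l2dist_sqE.
have sg : sqsum (coords g) by rewrite gE.
split; [exact/l2E|exact/l2E|move=> e e0 /=].
have [X fX [d1 d2]] := max_domain_graph_closure limit_point (conj sf sJf) e0.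
have [sX sJX] := max_domain_finsupp a b fX.
exists (of_coords X, jacobi_action A B (of_coords X)) => /=.
  by split=> //; apply/finitely_supportedE; rewrite of_coordsK.
by rewrite !l2dist_sqE ?coords_jacobi ?of_coordsK // !lte_fin gE.
Qed.

(** A pair in the adjoint graph, tested on unit vectors, is seen to be in the maximal
graph, which is the minimal one. *)
Lemma minimal_jacobi_selfadjoint : selfadjoint T.
Proof.
split.
  move=> f /l2E sf e e0.
  have [X fX d1] : exists2 X, finsupp X & sqnorm (coords f - X) < e. by apply: finsupp_dense.
  exists (of_coords X); last by rewrite l2dist_sqE ?of_coordsK ?lte_fin //; apply: sqsum_finsupp.
  exists (of_coords (jacs a b X)); apply/minimal_jacobiE; rewrite !of_coordsK; split=> //.
  exact: max_domain_finsupp.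
apply/seteqP; split=> -[g h].
  move=> /minimal_jacobiE[[sg sJg] hE]; split; [exact/l2E|by apply/l2E; rewrite /= hE|].
  move=> f Tf /minimal_jacobiE[Df fE] /=; rewrite !l2innerE hE fE.
  rewrite (green limit_point Df) // -jacs_mul_i (green limit_point Df) //.
  by split; rewrite ?jacs_mul_i; apply: sqsum_mul_i.
move=> [/= /l2E sg /l2E sh gh]; apply/minimal_jacobiE.
suff hE : coords h = jacs a b (coords g) by split=> //; split=> //; rewrite -hE.
apply/funext => n; apply/funext => i.
have fd := @finsupp_delta R _ n i.
have /gh : T (of_coords (delta R n i), of_coords (jacs a b (delta R n i))).
  by apply/minimal_jacobiE; rewrite !of_coordsK; split=> //; apply: max_domain_finsupp.
rewrite !l2innerE => -[+ _]; rewrite !of_coordsK innerC inner_jacs_finsupp //.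
by rewrite inner_delta innerC inner_delta.
Qed.

Lemma minimal_jacobi_resolvent_i : resolvent_set T (0 +i* 1).
Proof.
have resE f g : resolvent T (0 +i* 1) (g, f) <->
    max_domain a b (coords f) /\ jacs a b (coords f) - mul_i (coords f) = coords g.
  rewrite /resolvent /=; split=> [/minimal_jacobiE[Df]|[Df E]].
    rewrite coords_shift /= scale0r add0r scale1r => E.
    by split=> //; rewrite -E addrK.
  apply/minimal_jacobiE; split=> //.
  by rewrite coords_shift /= scale0r add0r scale1r -E subrK.
split=> [g /l2E sg|].
  have [F [DF _ E]] := jacs_mul_i_surj limit_point sg.
  exists (of_coords F); split=> [|f /resE[Df E']]; first by apply/resE; rewrite of_coordsK.
  by rewrite -[f]coordsK; congr of_coords; apply: (jacs_mul_i_unique limit_point DF Df); rewrite E.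
exists 1 => g f /l2E sg /resE[Df E]; have [sf sJf] := Df.
rewrite mul1e !l2norm_sqE // lee_fin -E -scaleN1r.
rewrite (sqnorm_jacs_mul_i limit_point) // sqrrN expr1n mul1r lerDr.
exact: sqnorm_ge0.
Qed.

(** The weighted bound extends from finitely supported sequences to the whole domain with
the factor 4 because of the inequality (x + y)^2 <= 2 x^2 + 2 y^2, used once for an
entry and once for the norms. The resolvent maps bounded sequences to sequences
bounded for the graph norm, which are therefore dominated by a multiple of w. *)
Lemma minimal_jacobi_discrete (w : nat -> R) : (forall n, 0 <= w n) ->
  cvgn (series w) ->
  (forall X, finsupp X -> forall n i, X n i ^+ 2 <= w n * (sqnorm X + sqnorm (jacs a b X))) ->
  discrete_spectrum T.
Proof.
move=> w0 cw finw; split; first by exists (0 +i* 1); exact: minimal_jacobi_resolvent_i.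
have domw X : max_domain a b X -> forall n i,
    X n i ^+ 2 <= 4 * w n * (sqnorm X + sqnorm (jacs a b X)).
  move=> DX n i; have [sX sJX] := DX; apply/ler_addgt0Pr => e e0.
  have k0 : 0 < 8 * w n + 2 by have := w0 n; lra.
  have [Y fY [d1 d2]] := max_domain_graph_closure limit_point DX (divr_gt0 e0 k0).
  have [sY sJY] := max_domain_finsupp a b fY.
  have YE (U V : nat -> 'I_p * bool -> R) : V = U - (U - V) by rewrite opprB addrC subrK.
  have n1 : sqnorm Y <= 2 * sqnorm X + 2 * sqnorm (X - Y).
    by rewrite [in leLHS](YE X Y); apply: sqnormB_le => //; apply: sqsumB.
  have n2 : sqnorm (jacs a b Y) <= 2 * sqnorm (jacs a b X) + 2 * sqnorm (jacs a b X - jacs a b Y).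
    by rewrite [in leLHS](YE (jacs a b X) (jacs a b Y)); apply: sqnormB_le => //; apply: sqsumB.
  have xy : (X n i - Y n i) ^+ 2 <= sqnorm (X - Y) := sqr_coord_le n i (sqsumB sX sY).
  set t := e / _ in d1 d2.
  have -> : e = 8 * w n * t + 2 * t by rewrite -mulrDl /t mulrC divfK // gt_eqF.
  have h1 := finw _ fY n i.
  have h2 : w n * (sqnorm Y + sqnorm (jacs a b Y)) <=
      w n * (2 * (sqnorm X + sqnorm (jacs a b X)) + 4 * t).
    by apply: ler_wpM2l => //; lra.
  have := sqr_ge0 (X n i - 2 * Y n i); lra.
move=> z [_ [M KM]] u v uv [N uN].
have uvE m : [/\ sqsum (coords (u m)), max_domain a b (coords (v m)) &
    coords (u m) + (complex.Re z *: coords (v m) + complex.Im z *: mul_i (coords (v m))) =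
    jacs a b (coords (v m))].
  have [/l2E su /minimal_jacobiE[Dv E]] := uv m; split=> //.
  by rewrite -E coords_shift.
have [C CP] : exists C, forall m, sqnorm (coords (v m)) + sqnorm (jacs a b (coords (v m))) <= C.
  have su m : 0 <= sqnorm (coords (u m)) <= N.
    have [s _ _] := uvE m; rewrite sqnorm_ge0 //=.
    by rewrite -lee_fin -l2norm_sqE.
  have sv m : sqnorm (coords (v m)) <= `|M| * N.
    have [s [sv _] _] := uvE m; have [/andP[u0 un]] := su m.
    have [ul uK] := uv m; have := KM _ _ ul uK.
    rewrite !l2norm_sqE // -EFinM lee_fin => /le_trans; apply.
    apply: (@le_trans _ _ (`|M| * sqnorm (coords (u m)))); last exact: ler_wpM2l.
    by apply: ler_wpM2r => //; apply: ler_norm.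
  pose V := `|M| * N.
  exists (V + 4 * N + 4 * complex.Re z ^+ 2 * V + 2 * complex.Im z ^+ 2 * V) => m.
  have [s [s1 s2] E] := uvE m; rewrite -E addrA.
  have h1 := sqnorm_comb_le (complex.Im z) (sqsumD (t := complex.Re z) s s1) (sqsum_mul_i s1).
  have h2 := sqnorm_comb_le (complex.Re z) s s1; rewrite sqnorm_mul_i in h1.
  have h3 := ler_wpM2l (sqr_ge0 (complex.Re z)) (sv m).
  have h4 := ler_wpM2l (sqr_ge0 (complex.Im z)) (sv m).
  have h5 := sv m; have /andP[h6 h7] := su m; rewrite -/V in h3 h4 h5; lra.
have C0 : 0 <= C.
  apply: le_trans (CP 0%N); have [_ [s1 s2] _] := uvE 0%N.
  by rewrite addr_ge0 // sqnorm_ge0.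
have [|m n i||phi [W [inc sVW sW cvgW]]] := @dominated_subsequence _ _ (fun m => coords (v m))
  ((4 * C) *: w).
- by move=> n; apply: mulr_ge0; rewrite ?mulr_ge0.
- have [_ Dv _] := uvE m; apply: le_trans (domw _ Dv n i) _.
  rewrite (_ : (4 * C *: w) n = 4 * w n * C); last by rewrite mulrAC.
  by apply: ler_wpM2l => //; rewrite mulr_ge0.
- exact: is_cvg_seriesZ.
exists phi, (of_coords W); split=> //; first by apply/l2E; rewrite of_coordsK.
rewrite (_ : (fun m => _) = (fun m => (sqnorm (coords (v (phi m)) - W))%:E)).
  by apply: cvg_EFin => //; apply: nearW.
apply/funext => m; have [_ [s1 _] _] := uvE (phi m).
by rewrite l2dist_sqE ?of_coordsK.
Qed.

End RealPicture.

(** * The Dirac coefficients *)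

Section Coefficients.
Variables (R : realType) (p : nat) (c : R) (d : nat -> R) (alpha : nat -> 'I_p -> R).
Local Open Scope complex_scope.

Definition diag_coef (k : 'I_p) (n : nat) : R :=
  if n == 0%N then 0
  else if odd n then - (nu c (d n./2.+1) / d n./2.+1 ^+ 2)
  else alpha n./2 k / d n./2.+1.

Definition offdiag_coef (n : nat) : R :=
  if odd n then nu c (d n./2.+1) / (d n./2.+1 `^ (3 / 2) * d n./2.+2 `^ (1 / 2))
  else nu c (d n./2.+1) / d n./2.+1 ^+ 2.

Lemma diagAE n : diagA c d alpha n = diag_mx (\row_k (diag_coef k n)%:C).
Proof.
apply/matrixP => i j; rewrite /diagA /diag_coef; case: eqP => _.
  by rewrite !mxE mul0rn.
by case: odd; rewrite !mxE.
Qed.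

Lemma offdiagBE n : offdiagB c d n = (offdiag_coef n)%:C%:M :> 'M[R[i]]_p.
Proof. by rewrite /offdiagB /offdiag_coef; case: odd. Qed.

Hypotheses (c_gt0 : 0 < c) (d_gt0 : forall n, (1 <= n)%N -> 0 < d n).
Hypothesis cd : cvgn (series (fun j => d j.+1)).

Let s j := Num.sqrt (d j.+1).
Let ga j := nu c (d j.+1) / d j.+1.
Let S := limn (series (fun j => d j.+1)).
Let g0 := c / Num.sqrt (1 + c ^+ 2 * S ^+ 2).

Lemma sqrt_d_gt0 j : 0 < s j. Proof. by rewrite sqrtr_gt0 d_gt0. Qed.

Lemma sqr_sqrt_d j : s j ^+ 2 = d j.+1.
Proof. by rewrite sqr_sqrtr // ltW // d_gt0. Qed.

Lemma d_le_sum j : d j.+1 <= S.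
Proof.
have d0 i : 0 <= d i.+1 by rewrite ltW // d_gt0.
apply: le_trans (series_le_lim j.+1 d0 cd).
by rewrite seriesSr lerDr sumr_ge0.
Qed.

Lemma sqrt_d_le j : s j <= Num.sqrt S.
Proof. by rewrite ler_wsqrtr // d_le_sum. Qed.

Lemma gammaE j : ga j = c / Num.sqrt (1 + c ^+ 2 * d j.+1 ^+ 2).
Proof.
have ? : d j.+1 != 0 by rewrite gt_eqF // d_gt0.
rewrite /ga /nu; field; apply/andP; split=> //.
by rewrite sqrtr_eq0 -ltNge ltr_pwDl // mulr_ge0 // sqr_ge0.
Qed.

Lemma root_gt0 (x : R) : 0 < Num.sqrt (1 + c ^+ 2 * x ^+ 2).
Proof. by rewrite sqrtr_gt0 ltr_pwDl // mulr_ge0 // sqr_ge0. Qed.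

Lemma gamma_min_gt0 : 0 < g0. Proof. by rewrite divr_gt0 // root_gt0. Qed.

Lemma gamma_ge j : g0 <= ga j.
Proof.
rewrite gammaE /g0 ler_pM2l // lef_pV2 ?posrE ?root_gt0 // ler_wsqrtr // lerD2l.
rewrite ler_wpM2l ?sqr_ge0 // ler_pXn2r ?nnegrE ?d_le_sum //.
  by rewrite ltW // d_gt0.
by apply: le_trans (d_le_sum j); rewrite ltW // d_gt0.
Qed.

Lemma gamma_le j : ga j <= c.
Proof.
rewrite gammaE ler_pdivrMr ?root_gt0 // -[leLHS]mulr1 ler_pM2l //.
by rewrite -[leLHS]sqrtr1 ler_wsqrtr // lerDl mulr_ge0 // sqr_ge0.
Qed.

Lemma diag_coef_even k j : diag_coef k j.*2.+2 = alpha j.+1 k / s j.+1 ^+ 2.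
Proof. by rewrite /diag_coef /= odd_double /= doubleK sqr_sqrt_d. Qed.

Lemma diag_coef_odd k j : diag_coef k j.*2.+1 = - (ga j / s j ^+ 2).
Proof.
rewrite /diag_coef /= odd_double /= uphalf_double sqr_sqrt_d /ga.
by congr (- _); field; rewrite gt_eqF // d_gt0.
Qed.

Lemma offdiag_coef_even j : offdiag_coef j.*2 = ga j / s j ^+ 2.
Proof.
rewrite /offdiag_coef odd_double doubleK sqr_sqrt_d /ga.
by field; rewrite gt_eqF // d_gt0.
Qed.

Lemma offdiag_coef_odd j : offdiag_coef j.*2.+1 = ga j / (s j * s j.+1).
Proof.
have dj := d_gt0 (ltn0Sn j).
rewrite /offdiag_coef /= odd_double /= uphalf_double /ga /s.
have -> : d j.+1 `^ (3 / 2) = d j.+1 * Num.sqrt (d j.+1).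
  rewrite (_ : 3 / 2 = 1 + 2^-1 :> R); last by lra.
  rewrite powRD ?powRr1 ?powR12_sqrt ?ltW //.
  by rewrite gt_eqF // implybT.
rewrite (_ : 1 / 2 = 2^-1 :> R); last by lra.
rewrite powR12_sqrt; last by rewrite ltW // d_gt0.
have := sqrt_d_gt0 j; have := sqrt_d_gt0 j.+1; rewrite /s => *.
by field; rewrite !gt_eqF.
Qed.

End Coefficients.

Section GrowthOfAlpha.
Variables (R : realType) (c : R) (d x : nat -> R).
Hypotheses (c_gt0 : 0 < c) (d_gt0 : forall n, (1 <= n)%N -> 0 < d n).
Hypothesis cd : cvgn (series (fun j => d j.+1)).
Hypothesis carleman : ~ cvgn (series (fun j => Num.sqrt (d j.+1 * d j.+2) * `|x j.+1|)).
Hypothesis x_neq0 : \forall n \near \oo, x n != 0.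

(** A lower bound on |c / x n| is an upper bound on |x n|, while the square root of
d_n d_{n+1} is at most d_n + d_{n+1}. *)
Lemma quotient_not_away (e : R) : 0 < e -> ~ \forall n \near \oo, e <= `|c / x n|.
Proof.
move=> e0 [N _ Ne]; apply: carleman.
pose v : nat -> R := (c / e) *: ((fun j => d j.+1) + (fun j => d j.+2)).
have d0 j : 0 <= d j.+1 by rewrite ltW // d_gt0.
have vE j : v j = c / e * (d j.+1 + d j.+2) by [].
have ce0 : 0 <= c / e by rewrite divr_ge0 ?ltW.
apply: (@series_le_cvg_near _ _ v N) => [n|n|n Nn|].
- by rewrite mulr_ge0 ?sqrtr_ge0.
- by rewrite vE mulr_ge0 ?addr_ge0.
- rewrite vE mulrC; apply: ler_pM => //.
    have := Ne _ (leqW Nn); rewrite /= normrM normfV (gtr0_norm c_gt0) => h.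
    have x0 : 0 < `|x n.+1|.
      rewrite normr_gt0; apply: contraTneq h => ->.
      by rewrite normr0 invr0 mulr0 -ltNge.
    by rewrite ler_pdivlMr // mulrC -ler_pdivlMr.
  (* Both sides are compared as square roots. *)
  have -> : d n.+1 + d n.+2 = Num.sqrt ((d n.+1 + d n.+2) ^+ 2).
    by rewrite sqrtr_sqr ger0_norm // addr_ge0.
  rewrite ler_wsqrtr //; have := d0 n; have := d0 n.+1; nra.
apply: is_cvg_seriesZ; apply: is_cvg_seriesD => //.
exact: (@cvg_series_shift _ (fun j => d j.+1)).
Qed.

(** Any limit other than 0, infinite ones included, would keep |c / x n| away from 0. *)
Lemma alpha_large : cvgn (fun n => (c / x n)%:E) ->
  \forall n \near \oo, 8 * c <= `|x n|.
Proof.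
move=> cq; set q := fun n => _ in cq.
have [l ql] : exists l : \bar R, q @ \oo --> l by exists (limn q).
case: l ql => [r| |] ql.
- have /fine_cvgP[_ {}ql] := ql.
  have {}ql : (fun n => c / x n) @ \oo --> r := ql.
  have [r0|r_neq0] := eqVneq r 0.
    have e0 : (0 : R) < 1 / 8 by lra.
    have /cvgrPdist_lt/(_ _ e0) := ql; rewrite r0 => near_q.
    near=> n.
    have xn : x n != 0 by near: n.
    have : `|0 - c / x n| < 1 / 8 by near: n.
    rewrite sub0r normrN normrM normfV (gtr0_norm c_gt0) ltr_pdivrMr ?normr_gt0 //.
    lra.
  have e0 : 0 < `|r| / 2 by rewrite divr_gt0 ?normr_gt0.
  have /cvgrPdist_lt/(_ _ e0) near_q := ql.
  case: (quotient_not_away e0); apply: filterS near_q => n /=.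
  have := ler_normD (r - c / x n) (c / x n); rewrite subrK; lra.
- case: (@quotient_not_away 1) => //.
  have /cvgeryP/cvgryPge/(_ 1) := ql.
  by apply: filterS => n /= h; rewrite (le_trans h) // ler_norm.
case: (@quotient_not_away 1) => //.
have /cvgerNyP/cvgrNyPle/(_ (-1)) := ql.
by apply: filterS => n /= h; rewrite ler_normr; apply/orP; right; lra.
Unshelve. all: by end_near. Qed.

End GrowthOfAlpha.

Theorem theorem8p1 (R : realType) (p : nat) (p_gt0 : (0 < p)%N)
    (c : R) (d : nat -> R) (alpha : nat -> 'I_p -> R)
    (c_gt0 : 0 < c)
    (d_gt0 : forall n, (1 <= n)%N -> 0 < d n)
    (d_l1 : (\sum_(1 <= n <oo) (d n)%:E < +oo)%E)
    (alpha_mono : forall n, (1 <= n)%N -> forall i j : 'I_p, (i <= j)%N ->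
       `|alpha n i| <= `|alpha n j|)
    (carleman : (\sum_(1 <= n <oo)
       (Num.sqrt (d n * d n.+1) * `|alpha n (Ordinal p_gt0)|)%:E = +oo)%E) :
  selfadjoint (J_X_alpha c d alpha) /\
  ((fun n : nat => `|alpha n (Ordinal p_gt0)| / d n.+1) @ \oo --> +oo ->
   cvgn (fun n : nat => (c / alpha n (Ordinal p_gt0))%:E) ->
   ((- (1 / 4))%:E < limn (fun n : nat => (c / alpha n (Ordinal p_gt0))%:E))%E ->
   discrete_spectrum (J_X_alpha c d alpha)).
Proof.
set k0 := Ordinal p_gt0 in carleman *.
have d0 j : 0 <= d j.+1 by rewrite ltW // d_gt0.
have cd : cvgn (series (fun j => d j.+1)) by apply/nneseries_from1_finite.
have div0 : ~ cvgn (series (fun j => Num.sqrt (d j.+1 * d j.+2) * `|alpha j.+1 k0|)).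
  pose u n := Num.sqrt (d n * d n.+1) * `|alpha n k0|.
  have u0 n : 0 <= u n.+1 by rewrite mulr_ge0 ?sqrtr_ge0.
  by move/(nneseries_from1_finite u0); rewrite carleman ltxx.
have divk k : ~ cvgn (series (fun j =>
    Num.sqrt (d j.+1) * Num.sqrt (d j.+2) * `|alpha j.+1 k|)).
  move=> ck; apply: div0; apply: series_le_cvg ck => n.
  - by rewrite mulr_ge0 ?sqrtr_ge0.
  - by rewrite !mulr_ge0 ?sqrtr_ge0.
  by rewrite sqrtrM // ler_wpM2l ?mulr_ge0 ?sqrtr_ge0 // alpha_mono.
have LP k (x y : nat -> R) (L : R) : sqsum1 x -> sqsum1 y ->
    sqsum1 (jac (diag_coef c d alpha k) (offdiag_coef c d) x) ->
    sqsum1 (jac (diag_coef c d alpha k) (offdiag_coef c d) y) ->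
    wronskian (offdiag_coef c d) x y @ \oo --> L -> L = 0.
  move=> sx sy sX sY; apply: (@dirac_limit_point R (fun j => Num.sqrt (d j.+1)) (fun j => nu c (d j.+1) / d j.+1)
    (alpha^~ k) (diag_coef c d alpha k) (offdiag_coef c d) _ c _ (sqrt_d_gt0 d_gt0) (sqrt_d_le d_gt0 cd)
    (gamma_min_gt0 d c_gt0) (gamma_ge c_gt0 d_gt0 cd) (gamma_le c_gt0 d_gt0)
    (diag_coef_even c alpha d_gt0 k) (offdiag_coef_even c d_gt0) (offdiag_coef_odd c d_gt0)
    x y L sx sy sX sY (divk k)).
split.
  exact: (minimal_jacobi_selfadjoint (diagAE c d alpha) (offdiagBE p c d) LP).
(* Since x / 0 = 0, vanishing alpha n k0 would give a small quotient c / alpha n k0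
   without being large; the ratio condition rules them out. *)
move=> ratio cq _.
have neq0 : \forall n \near \oo, alpha n k0 != 0.
  have /cvgryPgt/(_ 0) := ratio; apply: filterS => n.
  by apply: contraTneq => ->; rewrite normr0 mul0r ltxx.
have [N _ large0] := alpha_large c_gt0 d_gt0 cd div0 neq0 cq.
have large k j : (N <= j)%N -> 8 * c <= `|alpha j.+1 k|.
  move=> Nj; apply: (@le_trans _ _ `|alpha j.+1 k0|); last exact: alpha_mono.
  exact: large0 _ (leqW Nj).
have /choice[K KP] (k : 'I_p) : exists K : R, 0 <= K /\ forall x (E : R),
    (exists M, forall n, (M <= n)%N -> x n = 0) -> (forall n, `|x n| <= E) ->
    (forall n, `|jac (diag_coef c d alpha k) (offdiag_coef c d) x n| <= E) ->
    forall n, `|x n| <= K * E * Num.sqrt (d n./2.+1).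
  have [K K0 KP] := @dirac_sup_bound R (fun j => Num.sqrt (d j.+1)) (fun j => nu c (d j.+1) / d j.+1)
    (alpha^~ k) (diag_coef c d alpha k) (offdiag_coef c d) _ c _ (sqrt_d_gt0 d_gt0) (sqrt_d_le d_gt0 cd)
    (gamma_min_gt0 d c_gt0) (gamma_ge c_gt0 d_gt0 cd) (gamma_le c_gt0 d_gt0)
    (diag_coef_even c alpha d_gt0 k) (diag_coef_odd c alpha d_gt0 k) (offdiag_coef_even c d_gt0)
    (offdiag_coef_odd c d_gt0) N (large k).
  by exists K; split=> // x E; apply: KP.
(* One weight for all the components. *)
pose K2 := \sum_k K k ^+ 2.
have K2_ge0 : 0 <= K2 by apply: sumr_ge0 => k _; rewrite sqr_ge0.
pose w : nat -> R := K2 *: (fun n => d n./2.+1).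
have wE n : w n = K2 * d n./2.+1 by [].
apply: (minimal_jacobi_discrete (diagAE c d alpha) (offdiagBE p c d) LP (w := w)).
- by move=> n; rewrite wE mulr_ge0.
- by apply: is_cvg_seriesZ; exact: (@cvg_series_half _ (fun j => d j.+1)).
move=> X fX n i; have [sX sJX] := max_domain_finsupp (diag_coef c d alpha) (offdiag_coef c d) fX.
set E2 := sqnorm X + _.
have X0 := sqnorm_ge0 sX; have JX0 := sqnorm_ge0 sJX.
have E20 : 0 <= E2 by rewrite addr_ge0.
have bound (y : R) : y ^+ 2 <= E2 -> `|y| <= Num.sqrt E2.
  by move=> yE; rewrite -sqrtr_sqr ler_wsqrtr.
have [KI0 KI] := KP i.1.
have : `|X n i| <= K i.1 * Num.sqrt E2 * Num.sqrt (d n./2.+1).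
  apply: (KI (X^~ i)) => [|m|m].
  - by case: fX => M XM; exists M => m /XM ->.
  - by apply: bound; apply: le_trans (sqr_coord_le m i sX) _; rewrite lerDl.
  - by apply: bound; apply: le_trans (sqr_coord_le m i sJX) _; rewrite lerDr.
rewrite -(@ler_pXn2r _ 2) ?nnegrE ?mulr_ge0 ?sqrtr_ge0 // real_normK ?num_real //.
rewrite !exprMn !sqr_sqrtr // => /le_trans; apply.
rewrite wE mulrAC; do 2![apply: ler_wpM2r => //].
by rewrite /K2 (bigD1 i.1) //= lerDl sumr_ge0 // => k _; rewrite sqr_ge0.
Qed.
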